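(* Let $(G,\alpha,T)$ be a virtually free group with a marking, and let $\rho,\rho':G\to \mathrm{Homeo}_+(\mathbb S^1)$ be two representations. Suppose that the two actions on $\mathbb S^1$ have proper ping-pong partitions $\Theta$ (for $\rho$ and $(G,\alpha,T)$) and $\Theta'$ (for $\rho'$ and $(G,\alpha,T)$) which are equivalent, i.e. there is a ping-pong equivalence between them. Then $\rho$ and $\rho'$ are semi-conjugate.
   Context: Conventions. ''Virtually free group'' means a finitely generated virtually free group which is not virtually cyclic. $\mathrm{Homeo}_+(\mathbb S^1)$ is the group of orientation-preserving homeomorphisms of $\mathbb S^1=\mathbb R/\mathbb Z$; $\mathrm{Homeo}_{\mathbb Z}(\mathbb R)$ is the group of homeomorphisms of $\mathbb R$ commuting with integer translations. Semi-conjugacy. Two representations $\rho,\rho':G\to\mathrm{Homeo}_+(\mathbb S^1)$ are semi-conjugate if there exist a monotone non-decreasing map $h:\mathbb R\to\mathbb R$ commuting with integer translations and two corresponding central lifts $\widehat\rho,\widehat\rho':\widehat G\to\mathrm{Homeo}_{\mathbb Z}(\mathbb R)$ (homomorphisms defined on one and the same central extension $\widehat G$ of $G$ by $\mathbb Z$, lifting $\rho$ and $\rho'$ respectively, with the generator of $\mathbb Z$ acting as $x\mapsto x+1$ in both) such that $h\,\widehat\rho(\widehat g)=\widehat\rho'(\widehat g)\,h$ for every $\widehat g\in\widehat G$. Markings. Trees are simplicial trees with oriented edges; $\mathrm{Isom}_+(X)$ is the group of automorphisms of the tree $X$ preserving the orientation of edges (so there are no edge inversions). A marking of $G$ is a proper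 (i.e. with finite stabilizers), cocompact action $\alpha:G\to\mathrm{Isom}_+(X)$ on a locally finite tree, together with a connected fundamental domain $T\subset X$: a minimal connected subset containing exactly one point of every orbit, whose boundary consists only of vertices of $X$ ($T$ may fail to be closed). The action is written on the left. Data attached to a marking. Let $\overline X=X/G=(V,E)$ be the quotient graph, $E$ being the set of oriented edges, with origin $o(e)$, target $t(e)$, reversed edge $\overline e$. $V$ is identified with the set of vertices of $T$. The edges contained in $T$ with both endpoints in $T$ project to a spanning tree of $\overline X$, also denoted $T=(V,E_T)$. Put $S=E\setminus E_T$. $G_v$ is the stabilizer of the vertex $v\in T$. For $e\in E_T$ let $\tilde e$ be its lift in $T$. For each pair $\{s,\overline s\}\subset S$, one of the two orientations, say $s$, has a lift $\tilde s$ whose interior lies in $T$, with $o(\tilde s)\in T$, $t(\tilde s)\notin T$; choose an element of $G$, still denoted $s$, with $s\cdot t(s)=t(\tilde s)$ (where $t(s)\in V$ is seen as a vertex of $T$), denote $s^{-1}$ by $\overline s$, and let the lift of the edge $\overline s$ be the reversed edge of $s^{-1}\cdot\tilde s$ (which starts at the vertex $t(s)$ of $T$). For $e\in E$, $\alpha_e(A_e)\subset G_{o(e)}$ is the stabilizer of the lift $\tilde e$. In this way $G\cong\pi_1(\overline X;G_v,A_e)$ and $G$ is generated by $\mathcal G=\bigcup_{v\in V}G_v\cup\bigcup_{s\in S}\alpha_s(A_s)s$ (the preferred system of generators). Write $\mathrm{St}_T(v)=\{e\in E_T: o(e)=v\}$, $\mathrm{St}_{\overline X}(v)=\{e\in E: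 o(e)=v\}$; for $e\in E_T$, $v\in V$, write $v\in C(e,T)$ if $e$ belongs to the oriented geodesic path in $T$ from $o(e)$ to $v$. Interactive family. Given an action of $G$ on a set $\Omega$, a family of subsets $\boxminus=\{X_v,Z_s\}_{v\in V,s\in S}$ of $\Omega$ is an interactive family if: (IF1) the subsets $X_v,Z_s$ are pairwise disjoint; the $Z_s$ are non-empty; and if $G_v\ne\alpha_e(A_e)$ for some $e\in E$ with $o(e)=v$, then $X_v\neq\emptyset$; (IF2) $s(O)\subset Z_s$ for every $s\in S$ and $O\in\boxminus\setminus\{Z_{\overline s}\}$; (IF3) $\alpha_s(A_s)(Z_s)\subset Z_s$ for every $s\in S$; (IF4) $(G_{o(s)}\setminus\alpha_s(A_s))(Z_s)\subset X_{o(s)}$ for every $s\in S$; (IF5) for $v\in V$ and $e\in\mathrm{St}_T(v)$ with $G_v\ne\alpha_e(A_e)$, $X_v$ contains a (specified) non-empty subset $X_v^e$; (IF6) $\alpha_e(A_e)(X_{o(e)}^e)\subset X_{o(e)}^e$ for every $e\in E_T$; (IF7) if $e\in E_T$ and $v\in C(e,T)$, then $(G_{o(e)}\setminus\alpha_e(A_e))(X_v)\subset X^e_{o(e)}$; (IF8) if $e\in E_T$ and $s\in S$ satisfy $o(s)\in C(e,T)$, then $(G_{o(e)}\setminus\alpha_e(A_e))(Z_s)\subset X^e_{o(e)}$. (Conditions mentioning $X^e_{o(e)}$ are understood for those $e$ for which it has been specified.) It is proper if moreover: (IF9) for $s\in S$ the action of $\alpha_s(A_s)$ restricted to $Z_s$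 is faithful, and for $e\in E_T$ the action of $\alpha_e(A_e)$ restricted to $X^e_{o(e)}$ is faithful; (IF10) if $X_v\ne\emptyset$ for some $v\in V$, then there is a (possibly different) $w\in V$ such that the union of all the images appearing in (IF4), (IF7), (IF8) inside $X_w$ (those with $o(s)=w$, resp. $o(e)=w$) misses a point of $X_w$; (IF11) if $S=\{s,\overline s\}$ and $X_v=\emptyset$ for every $v\in V$, then there is $p\in\Omega\setminus(Z_s\cup Z_{\overline s})$ with $s(p)\in Z_s$ and $\overline s(p)\in Z_{\overline s}$. Gaps and Markovian images. For a finite collection $\mathcal I$ of disjoint open intervals of $\mathbb S^1$, a gap is a connected component of $\mathbb S^1\setminus\bigcup_{I\in\mathcal I}I$; $\mathcal J$ is the collection of gaps. For a homeomorphism $g$ and $I\in\mathcal I$, $g(I)$ is $\mathcal I$-Markovian if it coincides with a union of intervals $I_0,\dots,I_m\in\mathcal I$ and gaps $J_1,\dots,J_m\in\mathcal J$, with $m\ge1$. Ping-pong partition. A ping-pong partition for $(G,\alpha,T)$, where $G$ acts on $\mathbb S^1$ by orientation-preserving homeomorphisms (here via $\rho$ or $\rho'$), is a collection $\Theta=\{U_v^e,V_s\}_{v\in V,e\in\mathrm{St}_{\overline X}(v),s\in S}$ of open subsets of $\mathbb S^1$ such that: (PPP1) with $U_v=\bigcup_{e\in\mathrm{St}_{\overline X}(v)}U_v^e$, the family $\{U_v,V_s\}$ (with $X_v=U_v$, $Z_s=V_s$, $\Omega=\mathbb S^1$) is an interactive family, and for every $v\in V$: the $U_v^e$, $e\in\mathrm{St}_T(v)$,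 are the subsets required in (IF5); for $s\in S$ with $o(s)=v$, $(G_v\setminus\alpha_s(A_s))(V_s)\subset U_v^s$ and $\alpha_s(A_s)(U_v^s)=U_v^s$; the $U_v^e$, $e\in\mathrm{St}_{\overline X}(v)$, are pairwise disjoint; (PPP2) every atom (element) of $\Theta$ is a union of finitely many intervals; (PPP3) for every $g\in\mathcal G$ and every connected component $I$ of some $O\in\Theta$, either there is $O'\in\Theta$ with $g(I)\subset O'$, or $g(I)$ is $\mathcal I$-Markovian, where $\mathcal I$ is the collection of connected components of elements of $\Theta$. It is proper if the interactive family $\{U_v,V_s\}$ is proper. Equivalence of partitions. Let $\Theta=\{U_v^e,V_s\}$, $\Theta'=\{{U_v^e}',V_s'\}$ be ping-pong partitions for $\rho,\rho'$ respectively, with collections of connected components $\mathcal I,\mathcal I'$. A map $\theta:\mathcal I\to\mathcal I'$ is a ping-pong equivalence if: (PPE1) $\theta$ is a bijection preserving the cyclic ordering of the intervals (it thus also induces a correspondence between gaps, still denoted $\theta$); (PPE2) $\theta$ preserves the inclusion relations: if $g\in\mathcal G$ and $I_1,I_2\in\mathcal I$ satisfy $\rho(g)(I_1)\subset I_2$, then $\rho'(g)(\theta(I_1))\subset\theta(I_2)$, and in case of equality, equality is preserved; and if $g\in\mathcal G$, $I\in\mathcal I$ are such that $\rho(g)(I)$ is $\mathcal I$-Markovian, union of intervals $I_0,\dots,I_m\in\mathcal I$ and gaps $J_1,\dots,J_m$, then $\rho'(g)(\theta(I))$ is $\mathcal I'$-Markovian, union of the intervals $\theta(I_0),\dots,\theta(I_m)$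 and the gaps $\theta(J_1),\dots,\theta(J_m)$. $\Theta$ and $\Theta'$ are equivalent if there is a ping-pong equivalence between them. *)

(* Defs.v *)
From HB Require Import structures.
From mathcomp Require Import all_boot all_order all_algebra.
From mathcomp Require Import all_classical all_reals all_analysis.
From Stdlib Require Relation_Operators.

Set Implicit Arguments.
Unset Strict Implicit.
Unset Printing Implicit Defensive.

Import Order.TTheory GRing.Theory Num.Theory.
Import numFieldNormedType.Exports.

Local Open Scope classical_set_scope.
Local Open Scope ring_scope.

(** * Groups *)

Definition subgroup (G : groupType) (H : set G) : Prop :=
  [/\ H 1%g, (forall x y, H x -> H y -> H (x * y)%g)
    & (forall x, H x -> H x^-1%g)].

Definition generated (G : groupType) (B : set G) : set G :=
  smallest (@subgroup G) B.

Definition finitely_generated (G : groupType) : Prop :=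
  exists2 B : set G, finite_set B & generated B = setT.

Definition finite_index (G : groupType) (H : set G) : Prop :=
  exists2 C : set G, finite_set C &
    forall g, exists c h, [/\ C c, H h & g = (c * h)%g].

(* The letter (b, true) stands for b and (b, false) for its inverse. *)
Definition word_value (G : groupType) (w : seq (G * bool)) : G :=
  foldr (fun a g => ((if a.2 then a.1 else a.1^-1) * g)%g) 1%g w.

Definition reduced_word (G : groupType) (w : seq (G * bool)) : bool :=
  sorted (fun a b => ~~ ((a.1 == b.1) && (a.2 != b.2))) w.

Definition free_subgroup (G : groupType) (H : set G) : Prop :=
  exists2 B : set G, generated B = H &
    forall w : seq (G * bool), (forall a, a \in w -> B a.1) ->
      reduced_word w -> w <> [::] -> word_value w <> 1%g.

Definition virtually_cyclic (G : groupType) : Prop :=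
  exists x : G, finite_index (generated [set x]).

(* Finite generation and the exclusion of virtually cyclic groups are part of
   the convention. *)
Definition virtually_free (G : groupType) : Prop :=
  [/\ finitely_generated G,
      (exists2 H : set G, free_subgroup H & finite_index H)
    & ~ virtually_cyclic G].

Definition is_action (G : groupType) (T : Type) (a : G -> T -> T) : Prop :=
  (forall x, a 1%g x = x) /\ (forall g h x, a (g * h)%g x = a g (a h x)).

(* The union of the translates g(U), for g in A. *)
Definition act_set (G : groupType) (T : Type) (a : G -> T -> T)
    (A : set G) (U : set T) : set T :=
  [set a g x | g in A & x in U].

(** * The circle R/Z *)

Section Circle.
Variable R : realType.

Definition circle_rel (x y : R) : bool := (x - y) \is a Num.int.

Lemma circle_rel_equiv : equiv_class_of circle_rel.
Proof.
split.
- by move=> x; rewrite /circle_rel subrr rpred0.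
- by move=> x y; rewrite /circle_rel -opprB rpredN.
- move=> y x z xy yz; rewrite /circle_rel.
  by rewrite -(subrK y x) -addrA rpredD.
Qed.

Canonical circle_equiv := EquivRelPack circle_rel_equiv.

Definition circle : topologicalType :=
  quotient_topology {eq_quot circle_equiv}%qT.

Definition circle_pi (x : R) : circle := (\pi_({eq_quot circle_equiv}%qT) x)%qT.

End Circle.

Definition homeomorphism (X Y : topologicalType) (f : X -> Y) : Prop :=
  continuous f /\ exists g : Y -> X, [/\ continuous g, cancel f g & cancel g f].

Definition commutes_with_translations (R : realType) (F : R -> R) : Prop :=
  forall (x : R) (n : int), F (x + n%:~R) = F x + n%:~R.

Definition HomeoZ (R : realType) (F : R -> R) : Prop :=
  homeomorphism F /\ commutes_with_translations F.

Definition lifts (R : realType) (F : R -> R) (f : circle R -> circle R) : Prop :=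
  forall x, circle_pi (F x) = f (circle_pi x).

(* An element of HomeoZ is increasing; a lift of an orientation-reversing
   homeomorphism would instead satisfy F (x + 1) = F x - 1. *)
Definition Homeo_plus (R : realType) (f : circle R -> circle R) : Prop :=
  homeomorphism f /\ exists2 F : R -> R, HomeoZ F & lifts F f.

Definition circle_representation (R : realType) (G : groupType)
    (rho : G -> circle R -> circle R) : Prop :=
  is_action rho /\ forall g, Homeo_plus (rho g).

Definition cyclic_order (R : realType) (x y z : circle R) : Prop :=
  exists a b c : R, [/\ a < b, b < c & c < a + 1] /\
    [/\ circle_pi a = x, circle_pi b = y & circle_pi c = z].

Definition set_cyclic_order (R : realType) (A B C : set (circle R)) : Prop :=
  forall x y z, A x -> B y -> C z -> cyclic_order x y z.

Definition circle_interval (R : realType) (A : set (circle R)) : Prop :=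
  [/\ A !=set0, A <> setT & connected A].

(** * Semi-conjugacy *)

(* [iota] identifies Z with the kernel of [p]. *)
Definition central_extension (E G : groupType) (iota : int -> E) (p : E -> G) :
    Prop :=
  [/\ (forall m n : int, iota (m + n) = (iota m * iota n)%g),
      injective iota,
      (forall (n : int) (x : E), commute (iota n) x)
    & [/\ (forall x y, p (x * y)%g = (p x * p y)%g),
          (forall g, exists x, p x = g)
        & (forall x, p x = 1%g <-> exists n, x = iota n)]].

Definition central_lift (R : realType) (E G : groupType)
    (iota : int -> E) (p : E -> G)
    (rho : G -> circle R -> circle R) (rhat : E -> R -> R) : Prop :=
  [/\ is_action rhat,
      (forall x, HomeoZ (rhat x)),
      (forall x, lifts (rhat x) (rho (p x)))
    & (forall t, rhat (iota 1) t = t + 1)].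

Definition semi_conjugate (R : realType) (G : groupType)
    (rho rho' : G -> circle R -> circle R) : Prop :=
  exists (h : R -> R) (E : groupType) (iota : int -> E) (p : E -> G)
         (rhat rhat' : E -> R -> R),
    [/\ {homo h : x y / x <= y} /\ commutes_with_translations h,
        central_extension iota p,
        central_lift iota p rho rhat,
        central_lift iota p rho' rhat'
      & forall (x : E) (t : R), h (rhat x t) = rhat' x (h t)].

(** * Graphs and trees *)

(* Graphs in the sense of Serre: every geometric edge is a pair {e, rev e} of
   oriented edges. *)
Record graph := Graph {
  vert : choiceType;
  edge : choiceType;
  org : edge -> vert;
  rev : edge -> edge;
  revK : involutive rev;
  rev_neq : forall e, rev e != e }.

Definition tgt (X : graph) (e : edge X) : vert X := org (rev e).

Fixpoint walk (X : graph) (x : vert X) (p : seq (edge X)) (y : vert X) : bool :=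
  if p is e :: q then (org e == x) && walk (tgt e) q y else x == y.

Definition reduced_walk (X : graph) (p : seq (edge X)) : bool :=
  sorted (fun e f => f != rev e) p.

Definition is_tree (X : graph) : Prop :=
  (exists x : vert X, True) /\
  forall x y : vert X,
    exists! p : seq (edge X), walk x p y /\ reduced_walk p.

(** * Markings *)

Record tree_action (G : groupType) := TreeAction {
  tree : graph;
  treeP : is_tree tree;
  tree_locally_finite : forall v : vert tree, finite_set [set e | org e = v];
  positive : edge tree -> bool;
  positive_rev : forall e, positive (rev e) = ~~ positive e;
  actV : G -> vert tree -> vert tree;
  actE : G -> edge tree -> edge tree;
  actVP : is_action actV;
  actEP : is_action actE;
  act_org : forall g e, org (actE g e) = actV g (org e);
  act_rev : forall g e, rev (actE g e) = actE g (rev e);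
  act_positive : forall g e, positive (actE g e) = positive e }.

Definition proper_action (G : groupType) (a : tree_action G) : Prop :=
  (forall v : vert (tree a), finite_set [set g : G | actV g v = v]) /\
  (forall e : edge (tree a), finite_set [set g : G | actE g e = e]).

Definition cocompact_action (G : groupType) (a : tree_action G) : Prop :=
  (exists2 K : set (vert (tree a)), finite_set K &
     forall v, exists g : G, K (actV g v)) /\
  (exists2 K : set (edge (tree a)), finite_set K &
     forall e, exists g : G, K (actE g e)).

(* A subset of (the realization of) a graph whose boundary consists of
   vertices is a union of vertices and open edges; it is given by its set of
   vertices TV and its set of edges TE, closed under reversal. *)
Section Subcomplex.
Variables (X : graph) (TV : set (vert X)) (TE : set (edge X)).

Definition in_cells (c : vert X + edge X) : Prop :=
  match c with inl v => TV v | inr e => TE e end.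

Definition cell_adjacent (c d : vert X + edge X) : Prop :=
  match c, d with
  | inr e, inl v => org e = v
  | inr e, inr f => f = rev e
  | _, _ => False
  end.

Definition cells_connected : Prop :=
  forall c d, in_cells c -> in_cells d ->
    Relation_Operators.clos_refl_sym_trans _
      (fun c1 c2 => [/\ in_cells c1, in_cells c2 & cell_adjacent c1 c2]) c d.

End Subcomplex.

(* As there are no inversions, T contains exactly one point of every orbit as
   soon as it contains exactly one vertex, resp. exactly one open edge, of every
   orbit of vertices, resp. of edges; T is then automatically minimal. *)
Record fundamental_domain (G : groupType) (a : tree_action G)
    (TV : set (vert (tree a))) (TE : set (edge (tree a))) : Prop := {
  fd_rev : forall e, TE e -> TE (rev e);
  fd_connected : cells_connected TV TE;
  fd_vert_ex : forall v, exists g : G, TV (actV g v);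
  fd_vert_uniq : forall (g : G) v, TV v -> TV (actV g v) -> actV g v = v;
  fd_edge_ex : forall e, exists g : G, TE (actE g e);
  fd_edge_uniq : forall (g : G) e, TE e -> TE (actE g e) -> actE g e = e }.

Record marking (G : groupType) := Marking {
  maction : tree_action G;
  mproper : proper_action maction;
  mcocompact : cocompact_action maction;
  TV : set (vert (tree maction));
  TE : set (edge (tree maction));
  mdomain : fundamental_domain TV TE }.

Definition mtree (G : groupType) (M : marking G) : graph := tree (maction M).

(** * The quotient graph of groups *)

(* A model of the quotient graph, the lifts of its vertices and edges, and the
   choice of the elements s of G. [lift_stable] treats the pair {s, rev s} of
   edges outside the spanning tree through the orientation s whose lift lies in
   T and starts in T. *)
Record marking_data (G : groupType) (M : marking G) := MarkingData {
  quo : graph;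
  projV : vert (mtree M) -> vert quo;
  projE : edge (mtree M) -> edge quo;
  proj_org : forall e, org (projE e) = projV (org e);
  proj_rev : forall e, rev (projE e) = projE (rev e);
  projV_surj : forall v, exists x, projV x = v;
  projE_surj : forall e, exists x, projE x = e;
  projV_orbit : forall x y, projV x = projV y <-> exists g : G, actV g x = y;
  projE_orbit : forall x y, projE x = projE y <-> exists g : G, actE g x = y;
  liftV : vert quo -> vert (mtree M);
  liftE : edge quo -> edge (mtree M);
  selt : edge quo -> G;
  liftVK : forall v, projV (liftV v) = v;
  liftV_T : forall v, TV (liftV v);
  lift_tree : forall x : edge (mtree M), TE x -> TV (org x) -> TV (tgt x) ->
    liftE (projE x) = x;
  lift_stable : forall x : edge (mtree M), TE x -> TV (org x) -> ~ TV (tgt x) ->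
    let s := projE x in
    [/\ liftE s = x,
        actV (selt s) (liftV (tgt s)) = tgt x,
        selt (rev s) = (selt s)^-1%g
      & liftE (rev s) = rev (actE (selt s)^-1%g x)] }.

Section MarkingData.
Variables (G : groupType) (M : marking G) (D : marking_data M).
Implicit Types (v : vert (quo D)) (e s : edge (quo D)).

Definition tree_edge : set (edge (quo D)) :=
  [set e | exists x : edge (mtree M),
     [/\ TE x, TV (org x), TV (tgt x) & projE D x = e]].

Definition stable_edge : set (edge (quo D)) := ~` tree_edge.

Definition vgroup v : set G := [set g | actV g (liftV v) = liftV v].

(* The subgroup alpha_e(A_e) of [vgroup (org e)]. *)
Definition egroup e : set G := [set g | actE g (liftE e) = liftE e].

Definition preferred_generators : set G :=
  [set g | (exists v, vgroup v g) \/
           (exists s a, [/\ stable_edge s, egroup s a & g = (a * selt s)%g])].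

(* [beyond e v]: v belongs to C(e, T). *)
Definition beyond e v : Prop :=
  exists p : seq (edge (quo D)),
    [/\ walk (org e) p v, reduced_walk p,
        (forall f, f \in p -> tree_edge f) & e \in p].

(** * Interactive families *)

Section Interactive.
Variables (Om : Type) (act : G -> Om -> Om).
Variables (X : vert (quo D) -> set Om) (Z Xe : edge (quo D) -> set Om).

(* Only the values Z s with s a stable edge are relevant, and only the values
   Xe e with e a tree edge and [vgroup (org e) <> egroup e] (the edges for which
   a subset of X (org e) is specified). *)
Definition specified e : Prop := tree_edge e /\ vgroup (org e) <> egroup e.

Definition outer e : set G := vgroup (org e) `\` egroup e.

Record interactive_family : Prop := {
  IF1_X : trivIset setT X;
  IF1_Z : trivIset stable_edge Z;
  IF1_XZ : forall v s, stable_edge s -> X v `&` Z s = set0;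
  IF1_Z0 : forall s, stable_edge s -> Z s !=set0;
  IF1_X0 : forall e, vgroup (org e) <> egroup e -> X (org e) !=set0;
  IF2_X : forall s v, stable_edge s -> act (selt s) @` X v `<=` Z s;
  IF2_Z : forall s s', stable_edge s -> stable_edge s' -> s' <> rev s ->
    act (selt s) @` Z s' `<=` Z s;
  IF3 : forall s, stable_edge s -> act_set act (egroup s) (Z s) `<=` Z s;
  IF4 : forall s, stable_edge s -> act_set act (outer s) (Z s) `<=` X (org s);
  IF5 : forall e, specified e -> Xe e !=set0 /\ Xe e `<=` X (org e);
  IF6 : forall e, specified e -> act_set act (egroup e) (Xe e) `<=` Xe e;
  IF7 : forall e v, specified e -> beyond e v ->
    act_set act (outer e) (X v) `<=` Xe e;
  IF8 : forall e s, specified e -> stable_edge s -> beyond e (org s) ->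
    act_set act (outer e) (Z s) `<=` Xe e }.

(* The union of the images that (IF4), (IF7) and (IF8) force into X w. *)
Definition inner_images (w : vert (quo D)) : set Om :=
  [set x | [\/ exists s, [/\ stable_edge s, org s = w &
                 act_set act (outer s) (Z s) x],
               exists e v, [/\ tree_edge e, org e = w, beyond e v &
                 act_set act (outer e) (X v) x]
             | exists e s, [/\ tree_edge e, org e = w, stable_edge s,
                 beyond e (org s) & act_set act (outer e) (Z s) x]]].

Definition faithful_on (A : set G) (U : set Om) : Prop :=
  forall g, A g -> (forall x, U x -> act g x = x) -> g = 1%g.

Record proper_interactive_family : Prop := {
  proper_IF : interactive_family;
  IF9_Z : forall s, stable_edge s -> faithful_on (egroup s) (Z s);
  IF9_Xe : forall e, specified e -> faithful_on (egroup e) (Xe e);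
  IF10 : (exists v, X v !=set0) -> exists w, X w `\` inner_images w !=set0;
  IF11 : forall s, stable_edge = [set s; rev s] -> (forall v, X v = set0) ->
    exists p, [/\ ~ Z s p, ~ Z (rev s) p,
                  Z s (act (selt s) p) & Z (rev s) (act (selt (rev s)) p)] }.

End Interactive.

(** * Ping-pong partitions *)

(* Since an edge e determines its origin v, the atom U_v^e is written [atomU e];
   only the values [atomV s] with s a stable edge are relevant. *)
Record atom_family (R : realType) := AtomFamily {
  atomU : edge (quo D) -> set (circle R);
  atomV : edge (quo D) -> set (circle R) }.

Section Atoms.
Variables (R : realType) (Th : atom_family R).

Definition unionU v : set (circle R) :=
  \bigcup_(e in [set e | org e = v]) atomU Th e.

Definition atoms : set (set (circle R)) :=
  [set O | (exists e, O = atomU Th e) \/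
           (exists2 s, stable_edge s & O = atomV Th s)].

End Atoms.
End MarkingData.

Definition components (T : topologicalType) (A : set T) : set (set T) :=
  [set connected_component A x | x in A].

Definition atom_components (R : realType) (G : groupType) (M : marking G)
    (D : marking_data M) (Th : atom_family D R) : set (set (circle R)) :=
  [set I | exists2 O, atoms Th O & components O I].

Definition gaps (R : realType) (II : set (set (circle R))) :
    set (set (circle R)) :=
  components (~` \bigcup_(I in II) I).

Definition markovian_decomposition (R : realType) (II : set (set (circle R)))
    (A : set (circle R)) (m : nat)
    (Is : 'I_m.+1 -> set (circle R)) (Js : 'I_m -> set (circle R)) : Prop :=
  [/\ (1 <= m)%N, (forall i, II (Is i)), (forall j, gaps II (Js j))
    & A = (\bigcup_(i in setT) Is i) `|` (\bigcup_(j in setT) Js j)].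

Definition markovian (R : realType) (II : set (set (circle R)))
    (A : set (circle R)) : Prop :=
  exists m (Is : 'I_m.+1 -> set (circle R)) (Js : 'I_m -> set (circle R)),
    markovian_decomposition II A Is Js.

Record ping_pong_partition (R : realType) (G : groupType) (M : marking G)
    (D : marking_data M) (rho : G -> circle R -> circle R)
    (Th : atom_family D R) : Prop := {
  PPP_open : forall O, atoms Th O -> open O;
  PPP1_family : interactive_family rho (unionU Th) (atomV Th) (atomU Th);
  PPP1_outer : forall s, stable_edge s ->
    act_set rho (outer s) (atomV Th s) `<=` atomU Th s;
  PPP1_inner : forall s, stable_edge s ->
    act_set rho (egroup s) (atomU Th s) = atomU Th s;
  PPP1_disjoint : forall v, trivIset [set e | org e = v] (atomU Th);
  PPP2 : forall O, atoms Th O ->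
    exists n (Js : 'I_n -> set (circle R)),
      (forall i, circle_interval (Js i)) /\ O = \bigcup_(i in setT) Js i;
  PPP3 : forall g I, preferred_generators D g -> atom_components Th I ->
    (exists2 O, atoms Th O & rho g @` I `<=` O) \/
    markovian (atom_components Th) (rho g @` I) }.

Definition proper_ping_pong_partition (R : realType) (G : groupType)
    (M : marking G) (D : marking_data M) (rho : G -> circle R -> circle R)
    (Th : atom_family D R) : Prop :=
  ping_pong_partition rho Th /\
  proper_interactive_family rho (unionU Th) (atomV Th) (atomU Th).

(** * Ping-pong equivalence *)

(* J is the gap that comes immediately after the open interval I, for the
   positive orientation: it contains the right endpoint of I. *)
Definition next_gap (R : realType) (I J : set (circle R)) : Prop :=
  exists a b : R, [/\ a < b, b <= a + 1,
    I = @circle_pi R @` [set t | a < t < b] & J (circle_pi b)].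

(* The correspondence between gaps induced by theta. *)
Definition gap_correspondence (R : realType) (II II' : set (set (circle R)))
    (theta : set (circle R) -> set (circle R)) (J J' : set (circle R)) : Prop :=
  [/\ gaps II J, gaps II' J'
    & exists I, [/\ II I, next_gap I J & next_gap (theta I) J']].

Record ping_pong_equivalence (R : realType) (G : groupType) (M : marking G)
    (D : marking_data M) (rho rho' : G -> circle R -> circle R)
    (Th Th' : atom_family D R)
    (theta : set (circle R) -> set (circle R)) : Prop := {
  PPE1_bij : set_bij (atom_components Th) (atom_components Th') theta;
  PPE1_cyclic : forall I1 I2 I3,
    atom_components Th I1 -> atom_components Th I2 -> atom_components Th I3 ->
    set_cyclic_order I1 I2 I3 ->
    set_cyclic_order (theta I1) (theta I2) (theta I3);
  PPE2_sub : forall g I1 I2, preferred_generators D g ->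
    atom_components Th I1 -> atom_components Th I2 ->
    rho g @` I1 `<=` I2 -> rho' g @` theta I1 `<=` theta I2;
  PPE2_eq : forall g I1 I2, preferred_generators D g ->
    atom_components Th I1 -> atom_components Th I2 ->
    rho g @` I1 = I2 -> rho' g @` theta I1 = theta I2;
  PPE2_markovian : forall g I, preferred_generators D g ->
    atom_components Th I ->
    forall m (Is : 'I_m.+1 -> set (circle R)) (Js : 'I_m -> set (circle R)),
      markovian_decomposition (atom_components Th) (rho g @` I) Is Js ->
      exists Js' : 'I_m -> set (circle R),
        (forall j, gap_correspondence (atom_components Th) (atom_components Th')
                     theta (Js j) (Js' j)) /\
        markovian_decomposition (atom_components Th') (rho' g @` theta I)
          (theta \o Is) Js' }.

Definition equivalent_partitions (R : realType) (G : groupType) (M : marking G)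
    (D : marking_data M) (rho rho' : G -> circle R -> circle R)
    (Th Th' : atom_family D R) : Prop :=
  exists theta, ping_pong_equivalence rho rho' Th Th' theta.

(* Main.v *)
Require Import Defs.
From HB Require Import structures.
From mathcomp Require Import all_boot all_order all_algebra.
From mathcomp Require Import all_classical all_reals all_analysis.
From mathcomp Require Import zify lra.
From Stdlib Require Relation_Operators.
Import Defs.

(** Two points of the two circles correspond if they lie in intervals that
    correspond under the ping-pong equivalence theta. The proof compares the
    lifts of the two actions at corresponding points; it does not compute the
    cyclic order of any orbit.

    Long correspondences exist. Since theta preserves inclusions, the pairs of
    corresponding points form an interactive family for the diagonal action of G
    on the product of the two circles (joint_interactive). For any interactive
    family of an infinite group and any finite subset K of G, some point has all
    its translates by K in the union of the family (covered_orbit): such points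
    are obtained by playing ping-pong along the geodesics of the tree that lead
    to an edge which points away from the domain and from its translates by the
    inverses of the elements of K. Hence for every finite K there are
    corresponding points whose translates by K all correspond.

    Generators have matched lifts. Cut the two circles at the right ends of two
    corresponding intervals; with respect to such a cut, each point of the line
    has made a number of turns. As theta preserves the cyclic order, another pair
    of corresponding cuts changes the difference of the numbers of turns of
    corresponding points by a constant (cuts_change). Now a generator or its
    inverse maps some interval onto an interval or onto a Markovian union
    (generator_not_contracting), and in the latter case the correspondence of
    gaps identifies the last interval of the union (markovian_cuts). So the
    generator carries corresponding cuts to corresponding cuts, and its two
    actions have lifts that preserve the equality of the numbers of turns of
    corresponding points (cuts_matched).

    Conclusion. Consider the pairs of lifts (F, F') of the two actions of an
    element of G that preserve the equality of the numbers of turns of those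
    points whose translates by some finite set correspond. Long correspondences
    show that such a pair is determined by the element up to a common integer
    translation, and that the distance between F and F' is uniformly bounded. As
    the generators have such lifts, these pairs form a central extension of G by
    the integers that acts on both lines, and h = sup (F'^-1 o F), over all these
    pairs, is finite, monotone and equivariant (matching_semi_conjugate). *)

Set Implicit Arguments.
Unset Strict Implicit.
Unset Printing Implicit Defensive.

Import Order.TTheory GRing.Theory Num.Theory.
Import numFieldNormedType.Exports.

Local Open Scope classical_set_scope.
Local Open Scope ring_scope.

(** * Walks in trees *)

Section Walks.
Variable X : graph.
Implicit Types (x y z : vert X) (e f : edge X) (p q : seq (edge X)).

Lemma tgt_rev e : tgt (rev e) = org e.
Proof. by rewrite /tgt revK. Qed.

Lemma walk_cat x p q z :
  walk x (p ++ q) z <-> exists2 y, walk x p y & walk y q z.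
Proof.
elim: p x => [|e p IH] x /=.
  by split=> [w|[y /eqP-> //]]; exists x.
split=> [/andP[-> /IH[y w1 w2]]|[y /andP[-> w1] w2]] /=; first by exists y.
by apply/IH; exists y.
Qed.

Lemma walk_rcons x p f y :
  walk x (rcons p f) y <-> walk x p (org f) /\ tgt f = y.
Proof.
rewrite -cats1 walk_cat; split=> [[z w /= /andP[/eqP-> /eqP->]]|[w <-]] //.
by exists (org f) => //=; rewrite !eqxx.
Qed.

Lemma walk_head x f p y : walk x (f :: p) y -> org f = x.
Proof. by move=> /= /andP[/eqP]. Qed.

Definition opposite_walk p := seq.rev (map (@rev X) p).

Lemma walk_opposite x p y : walk x p y -> walk y (opposite_walk p) x.
Proof.
elim: p x => [|e p IH] x /=; first by move/eqP->; rewrite eqxx.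
move=> /andP[/eqP<- /IH w]; rewrite /opposite_walk map_cons rev_cons.
by apply/walk_rcons; rewrite tgt_rev.
Qed.

Lemma reduced_opposite p : reduced_walk p -> reduced_walk (opposite_walk p).
Proof.
rewrite /reduced_walk /opposite_walk rev_sorted sorted_map.
apply: sub_sorted => e f /=.
by apply: contra => /eqP->; rewrite revK.
Qed.

Lemma reduced_catr p q : reduced_walk (p ++ q) -> reduced_walk q.
Proof. by move/cat_sorted2 => []. Qed.

Lemma reduced_catl p q : reduced_walk (p ++ q) -> reduced_walk p.
Proof. by move/cat_sorted2 => []. Qed.

Lemma reduced_glue p f q :
  reduced_walk (rcons p f) -> reduced_walk (f :: q) ->
  reduced_walk (p ++ f :: q).
Proof.
case: p => [|e p] //=; rewrite /reduced_walk /= rcons_path cat_path /=.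
by move=> /andP[-> ->].
Qed.

Lemma walk_reduce x p y : walk x p y ->
  exists q, [/\ walk x q y, reduced_walk q & {subset q <= p}].
Proof.
elim: p x => [|e p IH] x /=; first by move/eqP->; exists [::]; rewrite /= eqxx.
move=> /andP[/eqP<- /IH[[|f q] [w r s]]].
  by exists [:: e]; split=> //=; [rewrite eqxx|move=> g; rewrite !inE => ->].
have [fe|fe] := eqVneq f (rev e).
  exists q; split; last by move=> g gq; rewrite inE s ?orbT// inE gq orbT.
    by move: w; rewrite fe /= tgt_rev => /andP[].
  by move: r; apply: (@reduced_catr [:: f]).
exists [:: e, f & q]; split.
- by rewrite /= eqxx; exact: w.
- by rewrite /reduced_walk /= fe.
- move=> g; rewrite inE => /orP[/eqP->|/s]; first by rewrite mem_head.
  by rewrite inE => ->; rewrite orbT.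
Qed.

Definition away x f :=
  exists2 p, walk x p (org f) & reduced_walk (rcons p f).

Lemma away_extend x f q : away x f -> reduced_walk (f :: q) ->
  (exists y, walk (tgt f) q y) -> away x (last f q).
Proof.
case/lastP: q => [//|q g] [p w r] r' [y /walk_rcons[w' _]].
rewrite last_rcons; exists (p ++ f :: q).
  by apply/walk_cat; exists (org f) => //=; rewrite eqxx.
by rewrite rcons_cat rcons_cons; exact: reduced_glue.
Qed.

Hypothesis treeX : is_tree X.

Lemma reduced_walk_unique x y p q : walk x p y -> reduced_walk p ->
  walk x q y -> reduced_walk q -> p = q.
Proof.
move=> w1 r1 w2 r2; have [z [_ u]] := treeX.2 x y.
by rewrite -(u p) // -(u q).
Qed.

Lemma reduced_walk_exists x y : exists2 p, walk x p y & reduced_walk p.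
Proof. by have [p [[w r] _]] := treeX.2 x y; exists p. Qed.

Lemma away_or_rev x f : away x f \/ away x (rev f).
Proof.
have [p w r] := reduced_walk_exists x (org f).
case/lastP: p w r => [|p g] w r; first by left; exists [::].
have [fg|fg] := eqVneq f (rev g); last first.
  by left; exists (rcons p g) => //; rewrite -2!cats1 -catA;
     apply: reduced_glue => //; rewrite /reduced_walk /= fg.
right; exists p; last by rewrite fg revK.
by move: w => /walk_rcons[w _]; rewrite fg revK.
Qed.

(** The geodesics from x and y that end with f and with its reverse fit together
    along f into a reduced walk. *)
Lemma away_separates x y f : away x f -> away y (rev f) ->
  exists p, [/\ walk x p y, reduced_walk p & f \in p].
Proof.
move=> [p w r] [p' w' r']; exists (p ++ f :: opposite_walk p'); split.
- apply/walk_cat; exists (org f) => //=; rewrite eqxx /=.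
  exact: walk_opposite.
- apply: reduced_glue => //; have := reduced_opposite r'.
  by rewrite /opposite_walk map_rcons rev_rcons revK.
- by rewrite mem_cat mem_head orbT.
Qed.

(** The edges to avoid are those of the geodesics between the vertices of F. *)
Lemma finite_separating_edges (F : seq (vert X)) :
  exists B : seq (edge X), forall f, f \notin B ->
    (forall x, x \in F -> away x f) \/ (forall x, x \in F -> away x (rev f)).
Proof.
pose path x y := sval (cid2 (reduced_walk_exists x y)).
have pathP x y : walk x (path x y) y /\ reduced_walk (path x y).
  by rewrite /path; case: cid2.
have pathE x y f : away x f -> away y (rev f) -> f \in path x y.
  move=> a b; have [p [w r fp]] := away_separates a b.
  have [w' r'] := pathP x y.
  by rewrite -(reduced_walk_unique w r w' r').
exists (flatten [seq path x y | x <- F, y <- F]) => f fB.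
have noF x y : x \in F -> y \in F -> f \notin path x y.
  move=> xF yF; apply: contra fB => fp; apply/flattenP.
  by exists (path x y) => //; apply: allpairs_f.
case: F fB noF => [|x0 F] fB noF; first by left.
have [a0|a0] := away_or_rev x0 f; [left|right] => x xF.
  have [//|b] := away_or_rev x f.
  by have := noF x0 x (mem_head _ _) xF; rewrite pathE.
have [b|//] := away_or_rev x f.
by have := noF x x0 xF (mem_head _ _); rewrite pathE.
Qed.

End Walks.

(** * Fundamental domain *)

Section FundamentalDomain.
Variables (G : groupType) (M : marking G) (D : marking_data M).
Implicit Types (g h : G) (x y : vert (mtree M)) (e s : edge (quo D))
  (f : edge (mtree M)).

Local Notation lV := (liftV (m := D)).
Local Notation lE := (liftE (m := D)).

Lemma actV1 x : actV 1%g x = x. Proof. exact: (actVP _).1. Qed.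
Lemma actVM g h x : actV (g * h)%g x = actV g (actV h x).
Proof. exact: (actVP _).2. Qed.
Lemma actVK g x : actV g^-1%g (actV g x) = x.
Proof. by rewrite -actVM mulVg actV1. Qed.
Lemma actVVK g x : actV g (actV g^-1%g x) = x.
Proof. by rewrite -actVM mulgV actV1. Qed.
Lemma actE1 f : actE 1%g f = f. Proof. exact: (actEP _).1. Qed.
Lemma actEM g h f : actE (g * h)%g f = actE g (actE h f).
Proof. exact: (actEP _).2. Qed.
Lemma actEK g f : actE g^-1%g (actE g f) = f.
Proof. by rewrite -actEM mulVg actE1. Qed.
Lemma actEVK g f : actE g (actE g^-1%g f) = f.
Proof. by rewrite -actEM mulgV actE1. Qed.
Lemma act_tgt g f : tgt (actE g f) = actV g (tgt f).
Proof. by rewrite /tgt act_rev act_org. Qed.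

Lemma walk_act g x p y : walk x p y -> walk (actV g x) (map (actE g) p) (actV g y).
Proof.
elim: p x => [|f p IH] x /=; first by move/eqP->.
by move=> /andP[/eqP<- /IH]; rewrite act_org eqxx act_tgt.
Qed.

Lemma reduced_act g (p : seq (edge (mtree M))) :
  reduced_walk p -> reduced_walk (map (actE g) p).
Proof.
rewrite /reduced_walk sorted_map; apply: sub_sorted => e f /=.
apply: contra => /eqP; rewrite act_rev => /(congr1 (actE g^-1%g)).
by rewrite !actEK => ->.
Qed.

Lemma away_act g x f : away x f -> away (actV g x) (actE g f).
Proof.
move=> [p w r]; exists (map (actE g) p).
  by rewrite act_org; exact: walk_act.
by rewrite -map_rcons; exact: reduced_act.
Qed.

Lemma proj_tgt f : tgt (projE D f) = projV D (tgt f).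
Proof. by rewrite /tgt proj_rev proj_org. Qed.

Lemma projE_act g f : projE D (actE g f) = projE D f.
Proof. by apply/esym/projE_orbit; exists g. Qed.

Lemma projV_act g x : projV D (actV g x) = projV D x.
Proof. by apply/esym/projV_orbit; exists g. Qed.

Lemma liftV_proj x : TV x -> lV (projV D x) = x.
Proof.
move=> Tx; have /projV_orbit[g gx] := liftVK (projV D x).
have Tl := liftV_T (projV D x).
by rewrite -{2}gx; apply/esym/(fd_vert_uniq (mdomain M) Tl); rewrite gx.
Qed.

Lemma TE_endpoint f : TE f -> TV (org f) \/ TV (tgt f).
Proof.
move=> Tf; apply: contrapT => /not_orP[no nt].
have [g Tg] := fd_vert_ex (mdomain M) (org f).
have := @fd_connected _ _ _ _ (mdomain M) (inr f) (inl (actV g (org f))) Tf Tg.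
pose P (c : vert (mtree M) + edge (mtree M)) := c = inr f \/ c = inr (rev f).
suff inv c d : Relation_Operators.clos_refl_sym_trans _ (fun c1 c2 =>
    [/\ in_cells (TV (m := M)) (TE (m := M)) c1,
        in_cells (TV (m := M)) (TE (m := M)) c2
      & cell_adjacent c1 c2]) c d -> P c <-> P d.
  by move=> /inv[/(_ (or_introl erefl))[]].
elim=> {c d} [c d [inc ind adj]|c|c d _ ->|c d k _ -> _ ->] //.
case: c inc adj => [//|e] inc; case: d ind => [v|e'] ind /= adj; last first.
  rewrite {}adj in ind *; split=> [[[->]|[->]]|[|] [ef]].
  - by right.
  - by left; rewrite revK.
  - by right; rewrite -ef revK.
  - by left; rewrite -[e]revK ef revK.
split=> [[[ef]|[ef]]|[]//]; exfalso.
  by apply: no; move: ind; rewrite /= -adj ef.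
by apply: nt; move: ind; rewrite /= -adj ef.
Qed.

Lemma edge_rep e : exists2 f, TE f & projE D f = e.
Proof.
have [f <-] := projE_surj e; have [g Tg] := fd_edge_ex (mdomain M) f.
by exists (actE g f) => //; rewrite projE_act.
Qed.

Lemma tree_edgeP e : tree_edge e ->
  [/\ projE D (lE e) = e, TE (lE e), TV (org (lE e)) & TV (tgt (lE e))].
Proof. by move=> [f [Tf oT tT <-]]; rewrite lift_tree. Qed.

Lemma tree_edge_rev e : tree_edge e -> tree_edge (rev e).
Proof.
move=> [f [Tf oT tT <-]]; exists (rev f); split=> //; last by rewrite proj_rev.
  exact: (fd_rev (mdomain M)).
by rewrite tgt_rev.
Qed.

Lemma stable_edge_rev e : stable_edge e -> stable_edge (rev e).
Proof. by move=> se /tree_edge_rev; rewrite revK. Qed.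

Lemma liftE_rev_tree e : tree_edge e -> lE (rev e) = rev (lE e).
Proof.
move=> [f [Tf oT tT <-]]; rewrite proj_rev !lift_tree //.
  exact: (fd_rev (mdomain M)).
by rewrite tgt_rev.
Qed.

(** A marking describes the lift of a stable edge through the orientation that
    leaves the domain; the same formulas turn out to hold for both
    orientations. *)
Lemma stable_edgeP s : stable_edge s ->
  [/\ projE D (lE s) = s, org (lE s) = lV (org s),
      tgt (lE s) = actV (selt s) (lV (tgt s)),
      selt (rev s) = (selt s)^-1%g
    & lE (rev s) = rev (actE (selt s)^-1%g (lE s))].
Proof.
move=> st; have [f Tf fs] := edge_rep s.
wlog oT : s f st Tf fs / TV (org f).
  move=> hw; have [oT|tT] := TE_endpoint Tf; first exact: (hw s f).
  have Tr := fd_rev (mdomain M) Tf.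
  have [||p1 p2 p3 p4 p5] := hw (rev s) (rev f) (stable_edge_rev st) Tr => //.
    by rewrite -proj_rev fs.
  rewrite revK in p4 p5.
  have st1 : selt s = (selt (rev s))^-1%g by rewrite p4.
  split.
  - by rewrite p5 -proj_rev projE_act p1 revK.
  - rewrite p5 -/(tgt _) act_tgt p3 actVK; congr lV.
    by rewrite tgt_rev.
  - by rewrite p5 tgt_rev act_org p2 st1.
  - by rewrite st1 invgK.
  - by rewrite p5 st1 invgK -act_rev revK actEVK.
have ntf : ~ TV (tgt f) by move=> tT; apply: st; exists f.
have := lift_stable D Tf oT ntf; rewrite fs /= => -[l1 l2 l3 l4].
split=> //; rewrite l1 //.
by rewrite -(liftV_proj oT) -proj_org fs.
Qed.

Lemma projE_lift e : projE D (lE e) = e.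
Proof.
by have [/tree_edgeP[]|/stable_edgeP[]] := pselect (tree_edge e).
Qed.

Lemma org_lift e : org (lE e) = lV (org e).
Proof.
have [te|/stable_edgeP[] //] := pselect (tree_edge e).
by have [p _ T _] := tree_edgeP te; rewrite -(liftV_proj T) -proj_org p.
Qed.

Lemma tgt_lift_tree e : tree_edge e -> tgt (lE e) = lV (tgt e).
Proof.
move=> te; have [p _ _ T] := tree_edgeP te.
by rewrite -(liftV_proj T) -proj_tgt p.
Qed.

Lemma edge_at_domain f : TV (org f) ->
  exists2 h, vgroup (org (projE D f)) h & f = actE h (lE (projE D f)).
Proof.
move=> Tf; have /projE_orbit[h hf] := projE_lift (projE D f).
exists h => //; rewrite /vgroup /= -org_lift.
apply: (fd_vert_uniq (mdomain M)); first by rewrite org_lift; exact: liftV_T.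
by rewrite -act_org hf.
Qed.

Lemma egroup_rev_tree e : tree_edge e -> egroup (rev e) = egroup e.
Proof.
move=> te; rewrite /egroup liftE_rev_tree //; apply/seteqP; split=> g /=.
  by rewrite -act_rev => /(congr1 (@rev _)); rewrite !revK.
by rewrite -act_rev => ->.
Qed.

Lemma egroup_sub e : egroup e `<=` vgroup (org e).
Proof. by move=> g /= /(congr1 (@org _)); rewrite act_org org_lift. Qed.

(** Along a geodesic from a vertex of the domain to its translate by g, each edge
    is crossed by means of an element of a vertex stabilizer, followed by a
    stable letter when the edge does not come from the spanning tree. *)
Lemma generation (H : set G) : H 1%g ->
  (forall g h, H g -> H h -> H (g * h)%g) ->
  (forall v : vert (quo D), vgroup v `<=` H) ->
  (forall s : edge (quo D), stable_edge s -> H (selt s)) ->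
  forall g, H g.
Proof.
move=> H1 HM Hv Hs g; have [x0 _] := (treeP (maction M)).1.
pose v := projV D x0.
have [p w _] := reduced_walk_exists (treeP (maction M)) (lV v) (actV g (lV v)).
suff [h [u [Hh gu]]] : exists h u, H h /\ actV g (lV v) = actV h (lV u).
  have uv : u = v by rewrite -(liftVK u) -(projV_act h) -gu projV_act liftVK.
  have Hhg : H (h^-1 * g)%g.
    by apply: (Hv v); rewrite /vgroup /= actVM gu actVK uv.
  by have := HM _ _ Hh Hhg; rewrite mulgA mulgV mul1g.
have : exists h u, H h /\ lV v = actV h (lV u) by exists 1%g, v; rewrite actV1.
move: (actV g (lV v)) w => z w.
elim: p (lV v) w => [|f p IH] x /=; first by move/eqP->.
move=> /andP[/eqP<- w] [h [u [Hh fu]]]; apply: IH w _.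
have [|b vb fb] := @edge_at_domain (actE h^-1%g f).
  by rewrite act_org fu actVK; exact: liftV_T.
move: vb fb; rewrite projE_act => vb /(congr1 (actE h)); rewrite actEVK -actEM.
move=> ->; set e := projE D f; have Hhb := HM _ _ Hh (Hv _ _ vb).
have [te|se] := pselect (tree_edge e).
  by exists (h * b)%g, (tgt e); rewrite act_tgt tgt_lift_tree.
have [_ _ t _ _] := stable_edgeP se.
exists (h * b * selt e)%g, (tgt e); rewrite act_tgt t -actVM; split=> //.
exact: HM _ _ Hhb (Hs _ se).
Qed.

Lemma lift_tree_walk u p v : walk u p v -> (forall e, e \in p -> tree_edge e) ->
  walk (lV u) (map lE p) (lV v).
Proof.
elim: p u => [|e p IH] u /=; first by move=> /eqP->.
move=> /andP[/eqP<- w] te; rewrite org_lift eqxx /= tgt_lift_tree; last first.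
  by apply: te; rewrite mem_head.
by apply: IH => // e' e'p; apply: te; rewrite inE e'p orbT.
Qed.

Lemma lift_tree_reduced (p : seq (edge (quo D))) : reduced_walk p ->
  (forall e, e \in p -> tree_edge e) -> reduced_walk (map lE p).
Proof.
rewrite /reduced_walk sorted_map => r te.
have : all (fun e => `[< tree_edge e >]) p by apply/allP => e /te/asboolT.
move=> al; apply: sub_in_sorted al r => e f /asboolP tre _ /=; apply: contra => /eqP.
by rewrite -liftE_rev_tree // => /(congr1 (projE D)); rewrite !projE_lift => ->.
Qed.

Lemma closed_tree_walk v p : walk v p v -> reduced_walk p ->
  (forall e, e \in p -> tree_edge e) -> p = [::].
Proof.
move=> w r te; have : map lE p = [::]; last by case: (p).
apply: (reduced_walk_unique (treeP (maction M)) (lift_tree_walk w te)) => //=.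
exact: lift_tree_reduced.
Qed.

(** A reduced walk in the spanning tree does not return to the origin of e, so
    that e can only be its first edge. *)
Lemma beyondP e v : beyond e v -> exists p,
  [/\ walk (tgt e) p v, reduced_walk (e :: p)
    & forall e', e' \in e :: p -> tree_edge e'].
Proof.
move=> [p [w r te /path.splitPr ep]]; case: ep w r te => p1 p2 w r te.
move: w => /walk_cat[y w1 w2]; have := walk_head w2 => ye.
have p10 : p1 = [::].
  apply: (@closed_tree_walk (org e)); first by rewrite {2}ye.
    exact: reduced_catl r.
  by move=> f fp; apply: te; rewrite mem_cat fp.
by rewrite p10 /= in r te w2; exists p2; split=> //; case/andP: w2.
Qed.

Lemma beyond_irrefl e : ~ beyond e (org e).
Proof.
move=> /beyondP[p [w r te]].
have : e :: p = [::]; last by [].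
by apply: (@closed_tree_walk (org e)) => //=; rewrite eqxx.
Qed.

Lemma beyond_tgt e : tree_edge e -> beyond e (tgt e).
Proof.
move=> te; exists [:: e]; rewrite /= !eqxx mem_head; split=> // f.
by rewrite inE => /eqP->.
Qed.

Lemma beyond_cons e1 e2 v : tree_edge e1 -> tgt e1 = org e2 -> e2 <> rev e1 ->
  beyond e2 v -> beyond e1 v.
Proof.
move=> te1 t12 ne /beyondP[p [w r te]]; exists [:: e1, e2 & p]; split.
- by rewrite /= !eqxx t12 eqxx.
- by rewrite /reduced_walk /=; apply/andP; split=> //; apply/eqP.
- by move=> f; rewrite inE => /orP[/eqP->|/te].
- exact: mem_head.
Qed.

End FundamentalDomain.

(** * Ping-pong on the tree *)

Lemma maximal_in_seq (T : eqType) (le : T -> T -> Prop) (s : seq T) :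
  (forall x, le x x) -> (forall y x z, le x y -> le y z -> le x z) -> s <> [::] ->
  exists2 x, x \in s & forall y, y \in s -> le x y -> le y x.
Proof.
move=> le_refl le_trans; elim: s => // a [_ _|b s /(_ _)[//|x xs xmax] _].
  by exists a; rewrite ?mem_head // => y; rewrite inE => /eqP->.
have [xa|xa] := pselect (le x a); last first.
  exists x; first by rewrite inE xs orbT.
  by move=> y; rewrite inE => /orP[/eqP->|/xmax//].
exists a => [|y]; first exact: mem_head.
rewrite inE => /orP[/eqP->//|/xmax yx ay].
exact: (le_trans x _ _ (yx (le_trans _ _ _ xa ay)) xa).
Qed.

Lemma walk_leaves (Q : graph) (P : vert Q -> Prop) x p y : walk x p y ->
  P x -> ~ P y -> exists p1 e p2, [/\ p = p1 ++ e :: p2, P (org e) & ~ P (tgt e)].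
Proof.
elim: p x => [|e p IH] x /=; first by move=> /eqP->.
move=> /andP[/eqP<- w] Pe nPy.
have [Pt|nPt] := pselect (P (tgt e)); last by exists [::], e, p.
have [p1 [e' [p2 [-> Pe' nPe']]]] := IH _ w Pt nPy.
by exists (e :: p1), e', p2.
Qed.

Lemma finite_vgroup (G : groupType) (M : marking G) (D : marking_data M)
  (v : vert (quo D)) : finite_set (vgroup v).
Proof. exact: (mproper M).1. Qed.

Section PingPong.
Variables (G : groupType) (M : marking G) (D : marking_data M).
Variables (Om : Type) (act : G -> Om -> Om).
Variables (X : vert (quo D) -> set Om) (Z Xe : edge (quo D) -> set Om).
Hypothesis infG : infinite_set [set: G].
Hypothesis actP : is_action act.
Hypothesis HIF : interactive_family act X Z Xe.

Local Notation lV := (liftV (m := D)).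
Local Notation lE := (liftE (m := D)).
Implicit Types (g h : G) (v : vert (quo D)) (e s : edge (quo D))
  (f : edge (mtree M)) (y : Om).

Local Lemma act1 y : act 1%g y = y. Proof. exact: actP.1. Qed.
Local Lemma actM g h y : act (g * h)%g y = act g (act h y).
Proof. exact: actP.2. Qed.
Local Lemma actVK' g y : act g (act g^-1%g y) = y.
Proof. by rewrite -actM mulgV act1. Qed.

Definition covered : set Om :=
  [set y | (exists v, X v y) \/ exists2 s, stable_edge s & Z s y].

(** The part of the interactive family that lies beyond the lift of e, seen
    from the origin of e. *)
Definition straight_shadow e : set Om :=
  [set y | (tree_edge e /\ ((exists2 v, beyond e v & X v y) \/
             exists s, [/\ stable_edge s, beyond e (org s) & Z s y])) \/
           (stable_edge e /\ Z e y)].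

(** The part that lies beyond the other translates of the lift of e with the
    same origin. *)
Definition turned_shadow e : set Om :=
  [set y | (tree_edge e /\ Xe e y) \/ (stable_edge e /\ X (org e) y)].

Definition shadow f : set Om :=
  [set y | (f = lE (projE D f) -> straight_shadow (projE D f) y) /\
           (f <> lE (projE D f) -> turned_shadow (projE D f) y)].

Lemma turn_shadow e h y : outer e h -> straight_shadow e y ->
  turned_shadow e (act h y).
Proof.
move=> oh [[te sh]|[se Zy]]; last first.
  by right; split=> //; apply: (IF4 HIF se); exists h => //; exists y.
left; split=> //; have sp : specified e.
  by split=> // ve; case: oh => vh; apply; rewrite -ve.
case: sh => [[v bv Xy]|[s [ss bs Zy]]].
  by apply: (IF7 HIF sp bv); exists h => //; exists y.
by apply: (IF8 HIF sp ss bs); exists h => //; exists y.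
Qed.

Lemma turned_shadow_sub f y : TV (org f) -> f <> lE (projE D f) ->
  turned_shadow (projE D f) y -> X (org (projE D f)) y.
Proof.
move=> Tf nf [[te Xy]|[//]]; have [h vh fh] := edge_at_domain D Tf.
suff sp : specified (projE D f) by apply: (IF5 HIF sp).2.
split=> // ve; apply: nf; rewrite {1}fh.
by have : egroup (projE D f) h by rewrite -ve.
Qed.

Lemma shadow_covered f y : TV (org f) -> shadow f y -> covered y.
Proof.
move=> Tf [sh1 sh2]; have [fl|fl] := pselect (f = lE (projE D f)); last first.
  by left; exists (org (projE D f)); apply: turned_shadow_sub (sh2 fl).
case: (sh1 fl) => [[te [[v _ Xy]|[s [ss _ Zy]]]]|[se Zy]].
- by left; exists v.
- by right; exists s.
- by right; exists (projE D f).
Qed.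

Lemma shadow_of_straight f y : TV (org f) ->
  (forall h, vgroup (org (projE D f)) h -> f = actE h (lE (projE D f)) ->
     straight_shadow (projE D f) (act h^-1%g y)) -> shadow f y.
Proof.
move=> Tf st; have [h vh fh] := edge_at_domain D Tf; split=> [fl|nf].
  have := st 1%g; rewrite invg1 act1; apply; last by rewrite actE1.
  by rewrite /vgroup /= actV1.
rewrite -(actVK' h y); apply: turn_shadow; last exact: st.
by split=> // eh; apply: nf; rewrite {1}fh.
Qed.

(** Invariance under the stabilizer of the lift of e is required because the
    translate of this lift by g determines g only up to the stabilizer. *)
Definition seed e (A : set Om) :=
  A `<=` straight_shadow e /\ forall a y, egroup e a -> A y -> A (act a y).

Definition geodesic_to e f q g :=
  [/\ walk (org f) (f :: q) (tgt (last f q)), reduced_walk (f :: q)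
    & last f q = actE g (lE e)].

Lemma geodesic_to_act e f q g h : geodesic_to e f q g ->
  geodesic_to e (actE h f) (map (actE h) q) (h * g)%g.
Proof.
move=> [w r l]; split.
- by rewrite last_map act_tgt act_org; exact: (walk_act h w).
- exact: (reduced_act h r).
- by rewrite last_map l actEM.
Qed.

Lemma geodesic_to_behead e f f2 q g : geodesic_to e f (f2 :: q) g ->
  [/\ org f2 = tgt f, f2 <> rev f & geodesic_to e f2 q g].
Proof.
move=> [/= /andP[_ /andP[/eqP of2 w]] /andP[/eqP nf r] l].
by split=> //; split=> //=; rewrite eqxx.
Qed.

(** Ping-pong along a geodesic that leaves the domain and ends with the translate
    of the lift of e. By induction from its last edge, the image of the seed
    lies in the shadow of the second edge, once the domain has been moved across
    the first one if this first edge is stable. The axioms of interactive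
    families then bring it into the shadow of the first edge; the case that they
    leave out, a stable letter applied to the set of the reversed edge, is
    excluded because the geodesic does not backtrack. *)
Lemma seed_shadow e A f q g y : seed e A -> TV (org f) ->
  geodesic_to e f q g -> A y -> shadow f (act g y).
Proof.
move=> [As Ae]; have [n sq] : {n | size q = n} by exists (size q).
elim: n => [|n IH] in f q g y sq * => Tf geo Ay.
(* Moving by the inverse of h, one may assume that the geodesic starts with the
   lift of the edge e1. *)
all: apply: shadow_of_straight => // h vh fh; rewrite -actM.
all: have := geodesic_to_act h^-1%g geo; rewrite {1}fh actEK.
all: have := sq; rewrite -(size_map (actE h^-1%g)).
all: move: (map _ q) (h^-1 * g)%g (projE D f) => {fh vh h Tf geo sq}{}q {}g e1.
  case: q => // _ [_ _ /= el].
  have e1e : e1 = e by rewrite -(projE_lift e1) el projE_act projE_lift.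
  by rewrite e1e; apply: As; apply: Ae; rewrite // /egroup /= -el e1e.
case: q => // f2 q [sq] /geodesic_to_behead[of2 nf geo].
have [te1|se1] := pselect (tree_edge e1).
  have Tf2 : TV (org f2) by rewrite of2; have [] := tree_edgeP te1.
  have oe2 : tgt e1 = org (projE D f2).
    by rewrite proj_org of2 -proj_tgt projE_lift.
  have bt := beyond_tgt te1.
  have [sh1 sh2] := IH _ _ _ _ sq Tf2 geo Ay.
  left; split=> //; have [fl|fl] := pselect (f2 = lE (projE D f2)); last first.
    by left; exists (tgt e1) => //; rewrite oe2; apply: turned_shadow_sub (sh2 fl).
  have ne : projE D f2 <> rev e1.
    by move=> e2; apply: nf; rewrite fl e2 liftE_rev_tree.
  case: (sh1 fl) => [[te2 [[v bv Xv]|[s [ss bs Zs]]]]|[se2 Zy]].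
  - by left; exists v => //; apply: beyond_cons bv.
  - by right; exists s; split=> //; apply: beyond_cons bs.
  - by right; exists (projE D f2); rewrite -oe2.
right; split=> //.
(* The inverse of the stable letter s brings the target of the lift of e1 back
   into the domain. *)
have [_ oe1 te1 se1V le1V] := stable_edgeP se1.
set s := selt e1 in te1 se1V le1V.
pose f2' := actE s^-1%g f2; have Tf2 : TV (org f2').
  by rewrite act_org of2 te1 actVK; exact: liftV_T.
have oe2 : org (projE D f2') = tgt e1.
  by rewrite proj_org act_org of2 te1 actVK liftVK.
have nf' : f2' <> lE (rev e1).
  rewrite le1V => /(congr1 (actE s)); rewrite actEVK act_rev actEVK => f2l.
  exact: nf.
have := IH _ _ _ _ _ Tf2 (geodesic_to_act s^-1%g geo) Ay.
rewrite size_map => /(_ sq).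
have -> : act g y = act s (act (s^-1 * g)%g y) by rewrite actM actVK'.
move: (act _ y) => z sh.
have Xs v : X v z -> Z e1 (act s z).
  by move=> Xz; apply: (IF2_X HIF se1 (v := v)); exists z.
have Zs s' : stable_edge s' -> s' <> rev e1 -> Z s' z -> Z e1 (act s z).
  by move=> ss' ne Zz; apply: (IF2_Z HIF se1 ss' ne); exists z.
have [sh1 sh2] := sh.
have [fl|fl] := pselect (f2' = lE (projE D f2')); last first.
  exact: Xs (turned_shadow_sub Tf2 fl (sh2 fl)).
case: (sh1 fl) => [[te2 [[v bv Xv]|[s' [ss bs Zz]]]]|[se2 Zz]].
- exact: Xs Xv.
- apply: Zs Zz => // s'e; apply: (@beyond_irrefl _ _ _ (projE D f2')).
  by have := bs; rewrite s'e -[org (rev e1)]/(tgt e1) -oe2.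
- by apply: Zs Zz => // e2; apply: nf'; rewrite fl e2.
Qed.

Lemma away_covered e A (x : vert (mtree M)) g y : seed e A -> TV x ->
  away x (actE g (lE e)) -> A y -> covered (act g y).
Proof.
move=> sA Tx [p w r] Ay; move wq: (rcons p (actE g (lE e))) r => [|f q] r.
  by move: wq => /(congr1 size); rewrite size_rcons.
have lq : last f q = actE g (lE e).
  by have := congr1 (last f) wq; rewrite last_rcons.
have w' : walk x (f :: q) (tgt (last f q)).
  by rewrite -wq lq; apply/walk_rcons.
have ofx := walk_head w'; rewrite -ofx in Tx w'.
have geo : geodesic_to e f q g by split; [exact: w'|exact: r|exact: lq].
exact: shadow_covered Tx (seed_shadow sA Tx geo Ay).
Qed.

Lemma infinite_edge_orbit f (B : seq (edge (mtree M))) :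
  exists g, actE g f \notin B.
Proof.
apply: contrapT => /forallNP noB; apply: infG.
have -> : [set: G] = \bigcup_(b in [set` B]) [set g | actE g f = b].
  apply/seteqP; split=> // g _; exists (actE g f) => //=.
  by move/negP: (noB g) => /negPn.
apply: bigcup_finite => // b _.
have [[g0 g0f]|no] := pselect (exists g0, actE g0 f = b); last first.
  by apply: sub_finite_set (finite_set0 G) => g gf; apply: no; exists g.
apply: sub_finite_set (finite_image (fun h => g0 * h)%g ((mproper M).2 f)).
move=> g gf; exists (g0^-1 * g)%g; last by rewrite mulgA mulgV mul1g.
by rewrite /= actEM gf -g0f actEK.
Qed.

(** Some translate of f0 does not separate the translates of a vertex of the
    domain by the inverses of the elements of K. It points away from all of them,
    possibly after reversal, and the two seeds serve these two cases. *)
Lemma covered_two_seeds (K : seq G) f0 e1 A1 c1 e2 A2 c2 :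
  seed e1 A1 -> A1 !=set0 -> seed e2 A2 -> A2 !=set0 ->
  (forall x g, away x (actE g f0) -> away x (actE (g * c1)%g (lE e1))) ->
  (forall x g, away x (rev (actE g f0)) -> away x (actE (g * c2)%g (lE e2))) ->
  exists y, forall k, k \in K -> covered (act k y).
Proof.
move=> s1 [y1 Ay1] s2 [y2 Ay2] a1 a2; have [x0 _] := (treeP (maction M)).1.
have [g0 Tx] := fd_vert_ex (mdomain M) x0; set x := actV g0 x0 in Tx.
have [B BP] := finite_separating_edges (treeP (maction M))
  (map (fun k => actV k^-1%g x) K).
have [g gB] := infinite_edge_orbit f0 B.
have away_k k f : away (actV k^-1%g x) f -> away x (actE k f).
  by move=> /(away_act k); rewrite actVVK.
have [al|al] := BP _ gB.
  exists (act (g * c1)%g y1) => k kK; rewrite -actM mulgA.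
  apply: away_covered s1 Tx _ Ay1; apply: a1; rewrite actEM.
  by apply: away_k; apply: al; apply/mapP; exists k.
exists (act (g * c2)%g y2) => k kK; rewrite -actM mulgA.
apply: away_covered s2 Tx _ Ay2; apply: a2; rewrite actEM act_rev.
by apply: away_k; apply: al; apply/mapP; exists k.
Qed.

Lemma seed_stable s : stable_edge s -> seed s (Z s).
Proof.
move=> ss; split=> [y Zy|a y ea Zy]; first by right.
by apply: (IF3 HIF ss); exists a => //; exists y.
Qed.

Lemma seed_specified e : specified e -> seed (rev e) (Xe e).
Proof.
move=> sp; have [te ve] := sp; have tre := tree_edge_rev te.
split=> [y Xy|a y ea Xy].
  left; split=> //; left; exists (org e); last exact: (IF5 HIF sp).2.
  by rewrite -tgt_rev; apply: beyond_tgt.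
apply: (IF6 HIF sp); exists a; last by exists y.
by rewrite -(egroup_rev_tree te).
Qed.

Lemma finite_quotient_vertices :
  exists V : seq (vert (quo D)), forall v, v \in V.
Proof.
have [[K /finite_seqP[V ->] KP] _] := mcocompact M.
exists (map (projV D) V) => v; have [g gv] := KP (lV v).
by apply/mapP; exists (actV g (lV v)) => //; rewrite projV_act liftVK.
Qed.

Lemma maximal_vgroup : exists v : vert (quo D), forall u : vert (quo D),
  vgroup v `<=` vgroup u -> vgroup u `<=` vgroup v.
Proof.
have [V allV] := finite_quotient_vertices.
have [x0 _] := (treeP (maction M)).1.
have V0 : V <> [::] by move=> V0; have := allV (projV D x0); rewrite V0.
have [v _ vmax] := maximal_in_seq (fun v => @subset_refl _ (vgroup v))
  (fun v u w => @subset_trans _ (vgroup v) (vgroup u) (vgroup w)) V0.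
by exists v => u; apply: vmax.
Qed.

(** Without stable letters the infinite group is generated by the finite
    stabilizers of the vertices of the domain, so that these are not all
    contained in a maximal one. A walk from the vertex of this maximal stabilizer
    to a vertex whose stabilizer is not contained in it crosses an edge after
    which the stabilizers are no longer contained in the maximal one. Backwards
    from the end of this edge, it also crosses an edge after which they are no
    longer contained in the stabilizer of that end. *)
Lemma facing_specified : (forall s : edge (quo D), ~ stable_edge s) ->
  exists e1 e2 p, [/\ specified e1, specified e2,
    exists z, walk (tgt e1) p z, reduced_walk (e1 :: p)
    & last e1 p = rev e2].
Proof.
move=> nst; have te e : tree_edge e by apply: contrapT => /nst.
have [v vmax] := maximal_vgroup.
have [u nu] : exists u : vert (quo D), ~ (vgroup u `<=` vgroup v).
  apply: contrapT => /forallNP all_v; apply: infG.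
  apply: sub_finite_set (finite_vgroup v) => g _.
  have Hv (u : vert (quo D)) : vgroup u `<=` vgroup v.
    by apply: contrapT; apply: all_v.
  apply: (generation (H := vgroup v)) => //.
  - exact: actV1.
  - by move=> a b /= av bv; rewrite /vgroup /= actVM bv.
  - by move=> s /nst.
have [p0 w0 _] := reduced_walk_exists (treeP (maction M)) (lV v) (lV u).
have [p [w r _]] : exists q, [/\ walk v q u, reduced_walk q
    & {subset q <= map (projE D) p0}].
  apply: walk_reduce; rewrite -(liftVK v) -(liftVK u).
  move: (lV v) w0 => x; elim: p0 x => [|f p0 IH] x /= ; first by move=> /eqP->.
  by move=> /andP[/eqP<- /IH]; rewrite proj_org proj_tgt eqxx.
have [p1 [e [p2 [pE oe ne]]]] : exists p1 e p2, [/\ p = p1 ++ e :: p2,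
    vgroup (org e) `<=` vgroup v & ~ (vgroup (tgt e) `<=` vgroup v)].
  by apply: (walk_leaves (P := fun u => vgroup u `<=` vgroup v) w).
move: w r; rewrite {}pE -cat_rcons => /walk_cat[y w1 _] /reduced_catl r.
have ye : y = tgt e by move: w1 => /walk_rcons[].
have [q1 [e1 [q2 [qE oe1 te1]]]] : exists q1 e1 q2,
    [/\ rcons p1 e = q1 ++ e1 :: q2, ~ (vgroup (org e1) `<=` vgroup y)
      & ~ ~ (vgroup (tgt e1) `<=` vgroup y)].
  apply: (walk_leaves (P := fun u => ~ (vgroup u `<=` vgroup y)) w1) => //.
    by move=> vy; apply: ne; rewrite -ye; apply: vmax.
  by apply.
move: te1 => /contrapT te1.
have lq : last e1 q2 = e.
  by have := congr1 (last e) qE; rewrite last_rcons last_cat.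
exists e1, (rev e), q2; split.
- split=> // vge; apply: oe1; rewrite vge => g eg; apply: te1.
  by have := eg; rewrite -egroup_rev_tree // => /egroup_sub.
- split; first exact: te.
  rewrite egroup_rev_tree // => vge; apply: ne.
  move=> g; rewrite -[tgt e]/(org (rev e)) vge => /egroup_sub; exact: oe.
- by move: w1; rewrite qE => /walk_cat[z _ /= /andP[_ w2]]; exists y.
- by move: r; rewrite qE => /reduced_catr.
- by rewrite revK.
Qed.

(** The two seeds come from a stable edge and its reverse or, if all the edges
    belong to the spanning tree, from two edges that face each other. *)
Theorem covered_orbit (K : seq G) :
  exists y, forall k, k \in K -> covered (act k y).
Proof.
have [[s ss]|nst] := pselect (exists s : edge (quo D), stable_edge s).
  have ss' := stable_edge_rev ss.
  apply: (@covered_two_seeds K (lE s) s (Z s) 1%g (rev s) (Z (rev s)) (selt s)).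
  - exact: seed_stable.
  - exact: (IF1_Z0 HIF).
  - exact: seed_stable.
  - exact: (IF1_Z0 HIF).
  - by move=> x g; rewrite mulg1.
  - have [_ _ _ _ ->] := stable_edgeP ss.
    by move=> x g; rewrite -act_rev actEM actEVK act_rev.
have {}nst s : ~ @stable_edge _ _ D s by move=> ss; apply: nst; exists s.
have te e : @tree_edge _ _ D e by apply: contrapT => /nst.
have [e1 [e2 [p [s1 s2 [z w] r lp]]]] := facing_specified nst.
apply: (@covered_two_seeds K (lE e1) (rev e2) (Xe e2) 1%g (rev e1) (Xe e1) 1%g).
- exact: seed_specified.
- exact: (IF5 HIF s2).1.
- exact: seed_specified.
- exact: (IF5 HIF s1).1.
- move=> x g a; rewrite mulg1 -lp -(last_map lE) -(last_map (actE g)).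
  apply: away_extend => //.
    by have := reduced_act g (lift_tree_reduced r (fun e _ => te e)).
  exists (actV g (lV z)); rewrite act_tgt tgt_lift_tree //.
  by apply: walk_act; apply: lift_tree_walk.
- by move=> x g; rewrite mulg1 liftE_rev_tree // act_rev.
Qed.

End PingPong.

(** * Arcs of the circle *)

Section Arcs.
Variable R : realType.
Implicit Types (a b c d t u x y : R) (n m : int) (z : circle R)
  (I J K : set (circle R)).

Lemma circle_piP x y :
  circle_pi x = circle_pi y <-> exists n, x = y + n%:~R.
Proof.
split=> [/eqquotP/intrP[n xyn]|[n ->]].
  by exists n; rewrite -xyn addrC subrK.
by apply/eqquotP; rewrite /= /circle_rel addrC addKr intr_int.
Qed.

Lemma circle_pi_shift x n : circle_pi (x + n%:~R) = circle_pi x.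
Proof. by apply/circle_piP; exists n. Qed.

Lemma circle_pi_surj z : exists x, circle_pi x = z.
Proof. by exists (repr z); rewrite /circle_pi reprK. Qed.

Lemma circle_pi_continuous : continuous (@circle_pi R).
Proof. exact: pi_continuous. Qed.

Lemma int_le0 n : n%:~R < 1 :> R -> n%:~R <= 0 :> R.
Proof. by rewrite -[1]/(1%:~R) -[0]/(0%:~R) ltr_int ler_int; lia. Qed.

Lemma int_ge0 n : -1 < n%:~R :> R -> 0 <= n%:~R :> R.
Proof. by rewrite -[-1]/((-1)%:~R) -[0]/(0%:~R) ltr_int ler_int; lia. Qed.

Lemma int_eq0 n : -1 < n%:~R :> R -> n%:~R < 1 :> R -> n = 0.
Proof.
by move=> /int_ge0 + /int_le0; rewrite -[0]/(0%:~R) !ler_int; lia.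
Qed.

Lemma translate_in a t : exists n, a <= t + n%:~R < a + 1.
Proof.
exists (- Num.floor (t - a)); have := floor_itv (t - a).
by rewrite intrD rmorphN /=; lra.
Qed.

Definition circle_arc a b : set (circle R) := @circle_pi R @` [set t | a < t < b].

Lemma arcP a b t : circle_arc a b (circle_pi t) <-> exists n, a < t + n%:~R < b.
Proof.
split=> [[u uab /circle_piP[n un]]|[n tn]].
  by exists n; rewrite -un.
by exists (t + n%:~R) => //; exact: circle_pi_shift.
Qed.

Lemma arc_shift a b n : circle_arc (a + n%:~R) (b + n%:~R) = circle_arc a b.
Proof.
apply/seteqP; split=> z; have [t <-] := circle_pi_surj z => /arcP[m tm].
  by apply/arcP; exists (m - n); rewrite rmorphB /=; lra.
by apply/arcP; exists (m + n); rewrite rmorphD /=; lra.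
Qed.

Lemma open_circle (A : set (circle R)) :
  open A <-> open (@circle_pi R @^-1` A).
Proof. by []. Qed.

Lemma open_arc a b : open (circle_arc a b).
Proof.
apply/open_circle.
have -> : @circle_pi R @^-1` (circle_arc a b) =
    \bigcup_(n in [set: int]) [set` `]a - n%:~R, b - n%:~R[ ].
  apply/seteqP; split=> t /=.
    by move=> /arcP[n tn]; exists n => //=; rewrite in_itv /=; lra.
  by move=> [n _ /=]; rewrite in_itv /= => tn; apply/arcP; exists n; lra.
by apply: bigcup_open => n _; exact: interval_open.
Qed.

Lemma connected_arc a b : connected (circle_arc a b).
Proof.
have -> : circle_arc a b = @circle_pi R @` [set` `]a, b[ ].
  by rewrite /circle_arc; congr image; apply/seteqP; split=> t /=; rewrite in_itv.
apply: connected_continuous_connected.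
  by apply/connected_intervalP; exact: interval_is_interval.
by apply: continuous_subspaceT; exact: circle_pi_continuous.
Qed.

Lemma arc_nonempty a b : a < b -> circle_arc a b (circle_pi ((a + b) / 2)).
Proof. by move=> ab; apply/arcP; exists 0; rewrite addr0; lra. Qed.

Lemma arc_notin_right a b : b <= a + 1 -> ~ circle_arc a b (circle_pi b).
Proof.
move=> ba /arcP[n bn].
have n0 : n = 0 by apply: int_eq0; lra.
by move: bn; rewrite n0; lra.
Qed.

Lemma arc_complement a b z : a <= b <= a + 1 ->
  [\/ z = circle_pi a, z = circle_pi b, circle_arc a b z | circle_arc b (a + 1) z].
Proof.
move=> ab; have [t <-] := circle_pi_surj z; have [n tn] := translate_in a t.
have [ta|ta] := eqVneq (t + n%:~R) a.
  by constructor 1; rewrite -ta circle_pi_shift.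
have [tb|tb] := eqVneq (t + n%:~R) b.
  by constructor 2; rewrite -tb circle_pi_shift.
have [lt|lt] := ltP (t + n%:~R) b.
  by constructor 3; apply/arcP; exists n; rewrite lt; lra.
by constructor 4; apply/arcP; exists n; lra.
Qed.

Lemma arc_complement_disjoint a b z : a <= b <= a + 1 ->
  circle_arc a b z -> ~ circle_arc b (a + 1) z.
Proof.
move=> ab; have [t <-] := circle_pi_surj z => /arcP[n tn] /arcP[m tm].
have : m - n = 0 by apply: int_eq0; rewrite rmorphB /=; lra.
move=> /eqP; rewrite subr_eq0 => /eqP mE.
by rewrite mE in tm; lra.
Qed.

(** The complementary arc is open, so that the trace of the first arc on I is
    closed as well as open. *)
Lemma connected_two_arcs a b I : a <= b <= a + 1 -> connected I ->
  ~ I (circle_pi a) -> ~ I (circle_pi b) -> I `&` circle_arc a b !=set0 ->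
  I `<=` circle_arc a b.
Proof.
move=> ab cI na nb Iab.
have Ibc z : I z -> ~ circle_arc a b z -> circle_arc b (a + 1) z.
  move=> Iz nz; case: (arc_complement z ab) => // zE.
    by case: na; rewrite -zE.
  by case: nb; rewrite -zE.
suff <- : I `&` circle_arc a b = I by move=> z [].
apply: cI => //; first by exists (circle_arc a b) => //; exact: open_arc.
exists (~` circle_arc b (a + 1)); first by apply: open_closedC; exact: open_arc.
apply/seteqP; split=> z [Iz zI]; split=> //.
  exact: arc_complement_disjoint zI.
by apply: contrapT => nz; apply: zI; exact: Ibc.
Qed.

(** The ends of the component of a point are, on both sides, the nearest points
    outside the open set. *)
Lemma component_arc (O I : set (circle R)) : open O -> O <> setT ->
  components O I -> exists a b, [/\ a < b, b <= a + 1 & I = circle_arc a b].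
Proof.
move=> /open_circle; set S := _ @^-1` _ => oS OT [z Oz <-].
have [t tz] := circle_pi_surj z; rewrite -{}tz in Oz *.
have St : S t by [].
have Sshift x n : S (x + n%:~R) = S x by rewrite /S /= circle_pi_shift.
have ballS x : S x -> exists2 e : R, 0 < e & forall y, `|x - y| < e -> S y.
  by rewrite openE in oS => /oS /nbhs_ballP[e /= e0 eS]; exists e.
have [y0 nSy0] : exists y, ~ S y.
  apply: contrapT => /forallNP allS; apply: OT.
  apply/seteqP; split=> // w _; have [y <-] := circle_pi_surj w.
  exact: contrapT (allS y).
have [n yn] := translate_in t y0.
pose B := [set y | t <= y /\ ~ S y]; pose b := inf B.
have hB : has_inf B.
  by split; [exists (y0 + n%:~R); rewrite /B /= Sshift; split=> //; lra|
    exists t => y []].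
have tb : t <= b by apply: lb_le_inf; [exact: hB.1|move=> y []].
have lb y : B y -> b <= y by move=> By; apply: ge_inf => //; exact: hB.2.
have nSb : ~ S b.
  move=> /ballS[e e0 be]; have [y [ty nSy] yb] := inf_adherent e0 hB.
  have by_ := lb y (conj ty nSy); rewrite -/b in yb.
  by apply: nSy; apply: be; rewrite ltr_norml; lra.
have nSb1 : ~ S (b - 1) by rewrite -(Sshift _ 1) subrK.
have b1t : b - 1 < t.
  by rewrite ltNge; apply/negP => tb1; have := lb (b - 1) (conj tb1 nSb1); lra.
pose A := [set y | y <= t /\ ~ S y]; pose a := sup A.
have hA : has_sup A by split; [exists (b - 1); split=> //; lra|exists t => y []].
have at_ : a <= t by apply: ge_sup; [exact: hA.1|move=> y []].
have ua y : A y -> y <= a by move=> Ay; apply: ub_le_sup => //; exact: hA.2.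
have nSa : ~ S a.
  move=> /ballS[e e0 ae]; have [y [ty nSy] ya] := sup_adherent e0 hA.
  have ay := ua y (conj ty nSy); rewrite -/a in ya.
  by apply: nSy; apply: ae; rewrite ltr_norml; lra.
have ba : b <= a + 1 by have := ua (b - 1) (conj (ltW b1t) nSb1); lra.
have {}tb : t < b.
  by rewrite lt_neqAle tb andbT; apply/eqP => tb'; apply: nSb; rewrite -tb'.
have {}at_ : a < t.
  by rewrite lt_neqAle at_ andbT; apply/eqP => ta'; apply: nSa; rewrite ta'.
exists a, b; split=> //; first by lra.
have ab : circle_arc a b (circle_pi t) by apply/arcP; exists 0; rewrite addr0; lra.
apply/seteqP; split; last first.
  apply: connected_component_max => //; last exact: connected_arc.
  move=> _ [u /andP[au ub] <-]; apply: contrapT => nSu.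
  have [tu|ut] := leP t u; first by have := lb u (conj tu nSu); lra.
  by have := ua u (conj (ltW ut) nSu); lra.
apply: connected_two_arcs.
- by lra.
- exact: component_connected.
- by move=> /connected_component_sub.
- by move=> /connected_component_sub.
- by exists (circle_pi t); split=> //; exact: connected_component_refl.
Qed.

Lemma disjoint_arcs a b c d n : a < b -> c < d ->
  circle_arc a b `&` circle_arc c d = set0 -> b + n%:~R <= c \/ d <= a + n%:~R.
Proof.
move=> ab cd dis; apply: contrapT => /not_orP[/negP + /negP].
rewrite -!ltNge => cb ad.
have [u [u1 u2]] : exists u, (a + n%:~R < u < b + n%:~R) /\ (c < u < d).
  exists ((Num.max (a + n%:~R) c + Num.min (b + n%:~R) d) / 2).
  by rewrite /Num.max /Num.min; do 2 case: ifPn; lra.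
suff : (circle_arc a b `&` circle_arc c d) (circle_pi u) by rewrite dis.
split; apply/arcP; first by exists (- n); rewrite rmorphN /=; lra.
by exists 0; rewrite addr0.
Qed.

Definition right_end I b := exists a, [/\ a < b, b <= a + 1 & I = circle_arc a b].

Lemma right_end_shift I b n : right_end I b -> right_end I (b + n%:~R).
Proof.
move=> [a [ab ba ->]]; exists (a + n%:~R); rewrite arc_shift.
by split=> //; lra.
Qed.

Lemma right_end_notin I b : right_end I b -> ~ I (circle_pi b).
Proof. by move=> [a [_ ba ->]]; exact: arc_notin_right. Qed.

Lemma right_end_nonempty I b : right_end I b -> I !=set0.
Proof.
by move=> [a [ab _ ->]]; exists (circle_pi ((a + b) / 2)); exact: arc_nonempty.
Qed.

Lemma right_end_unique I b c : right_end I b -> right_end I c ->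
  exists n, c = b + n%:~R.
Proof.
move=> rb rc; have [m cm] := translate_in b c.
have := right_end_shift m rc; move: cm; set c1 := c + _ => c1b rc1.
exists (- m); suff : c1 = b by rewrite /c1 rmorphN /=; lra.
apply/eqP; rewrite eq_le (_ : b <= c1) ?andbT; last by lra.
rewrite leNgt; apply/negP => bc1.
have [a [ab ba IE]] := rb; have [d [dc cd IE']] := rc1.
have nc1 : c1 - 1 <= a.
  rewrite leNgt; apply/negP => ac; apply: (right_end_notin rc1).
  by rewrite IE; apply/arcP; exists (-1); lra.
pose u := (Num.max d b + c1) / 2.
have du : d < u < c1 by rewrite /u /Num.max; case: ifPn; lra.
have bu : b < u by rewrite /u /Num.max; case: ifPn; lra.
have : circle_arc a b (circle_pi u).
  by rewrite -IE IE'; apply/arcP; exists 0; rewrite addr0.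
move=> /arcP[n un]; have : (n + 1)%:~R <= 0 :> R.
  by have := @int_le0 (n + 1); rewrite rmorphD /=; apply; lra.
by rewrite rmorphD /=; lra.
Qed.

(** The midpoints of the two arcs cut the circle into two open arcs, and each of
    them contains exactly one of the two right ends. *)
Lemma right_ends_separated I J b c (C : set (circle R)) :
  right_end I b -> right_end J c -> I `&` J = set0 -> connected C ->
  C `&` I = set0 -> C `&` J = set0 -> C (circle_pi b) -> C (circle_pi c) ->
  False.
Proof.
move=> rb rc; have [m cm] := translate_in b c.
rewrite -(circle_pi_shift c m); have := right_end_shift m rc.
move: (c + m%:~R) cm => {rc m}c1 bc1 [d [dc cd JE]].
have [a [ab ba IE]] := rb; rewrite {}IE {}JE => dis cC CI CJ Cb Cc.
have bd : b <= d.
  by have [] := disjoint_arcs 0 ab dc dis; rewrite !addr0 => //; lra.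
have ca : c1 <= a + 1.
  by have [] := disjoint_arcs 1 ab dc dis => //; lra.
pose p := (a + b) / 2; pose q := (d + c1) / 2.
have Cp : ~ C (circle_pi p).
  move=> Cp; suff : (C `&` circle_arc a b) (circle_pi p) by rewrite CI.
  by split=> //; exact: arc_nonempty.
have Cq : ~ C (circle_pi q).
  move=> Cq; suff : (C `&` circle_arc d c1) (circle_pi q) by rewrite CJ.
  by split=> //; exact: arc_nonempty.
have pq : p <= q <= p + 1 by rewrite /p /q; lra.
have bpq : circle_arc p q (circle_pi b).
  by apply/arcP; exists 0; rewrite addr0 /p /q; lra.
apply: (arc_complement_disjoint (z := circle_pi c1) pq).
  apply: (connected_two_arcs pq cC Cp Cq) => //.
  by exists (circle_pi b).
by apply/arcP; exists 0; rewrite addr0 /p /q; lra.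
Qed.

Lemma left_near (P : R -> Prop) e c : e < c -> (forall t, e < t < c -> P t) ->
  \forall t \near c^'-, P t.
Proof.
move=> ec eP; near=> t; apply: eP; apply/andP; split; near: t.
  exact: nbhs_left_gt.
exact: nbhs_left_lt.
Unshelve. all: by end_near. Qed.

(** Just before c, the arc is covered neither by a closed set, which would
    contain c, nor by an arc of the union that ends elsewhere. *)
Lemma last_arc (m n : nat) p c (Is : 'I_m -> set (circle R))
    (Js : 'I_n -> set (circle R)) :
  p < c -> c <= p + 1 ->
  (forall i, exists b, right_end (Is i) b) -> (forall j, closed (Js j)) ->
  circle_arc p c = (\bigcup_(i in setT) Is i) `|` (\bigcup_(j in setT) Js j) ->
  exists i, right_end (Is i) c.
Proof.
move=> pc cp rI cJ pcE; apply: contrapT => /forallNP noI.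
have nc : ~ circle_arc p c (circle_pi c) by exact: arc_notin_right.
have nI i : \forall t \near c^'-, ~ Is i (circle_pi t).
  have [b rb] := rI i; have [k bk] := translate_in (c - 1) b.
  have := right_end_shift k rb; move: (b + k%:~R) bk => {rb k}b bc rb.
  have bNc : b != c - 1.
    apply/eqP => bc1; apply: (noI i); have := right_end_shift 1 rb.
    by rewrite bc1 subrK.
  have [a [ab ba IE]] := rb.
  have nIc : ~ Is i (circle_pi c).
    by move=> Ic; apply: nc; rewrite pcE; left; exists i.
  have ca : c <= a + 1.
    rewrite leNgt; apply/negP => ac; apply: nIc; rewrite IE.
    apply/arcP; exists (-1); rewrite rmorphN /=; move: bNc.
    by rewrite neq_lt => /orP[]; lra.
  apply: (@left_near _ b); first by lra.
  move=> t tbc; rewrite IE => tab.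
  apply: (arc_complement_disjoint _ tab); first by lra.
  by apply/arcP; exists 0; rewrite addr0; lra.
have nJ j : \forall t \near c^'-, ~ Js j (circle_pi t).
  have : open (@circle_pi R @^-1` ~` Js j).
    by apply: open_comp; [move=> *; exact: circle_pi_continuous|exact: closed_openC].
  rewrite openE => /(_ c) [].
    by move=> Jc; apply: nc; rewrite pcE; right; exists j.
  move=> /= e e0 ce; apply: (@left_near _ (c - e)); first by lra.
  by move=> t tc; apply: (ce t); rewrite /ball /= ltr_norml; lra.
have pt : \forall t \near c^'-, circle_arc p c (circle_pi t).
  apply: (left_near pc) => t tpc; apply/arcP; exists 0; rewrite addr0; lra.
suff : \forall t \near c^'-, False by move=> /filter_ex[].
have nI' : \forall t \near c^'-, forall i, ~ Is i (circle_pi t).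
  exact: filter_forall.
have nJ' : \forall t \near c^'-, forall j, ~ Js j (circle_pi t).
  exact: filter_forall.
near=> t; have tI : forall i, ~ Is i (circle_pi t) by near: t.
have tJ : forall j, ~ Js j (circle_pi t) by near: t.
have : circle_arc p c (circle_pi t) by near: t.
by rewrite pcE => -[[i _ /tI]|[j _ /tJ]].
Unshelve. all: by end_near. Qed.

(** * Cutting the circle at the ends of an interval *)

Lemma floor_cut b c t : b <= c < b + 1 ->
  (Num.floor (t - b) = Num.floor (t - c) + 1 /\ exists m, b <= t + m%:~R < c) \/
  (Num.floor (t - b) = Num.floor (t - c) /\ exists m, c <= t + m%:~R < b + 1).
Proof.
move=> bc; have [m tm] := translate_in b t.
have -> : Num.floor (t - b) = - m.
  by apply: floor_def; rewrite rmorphD rmorphN /=; lra.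
have [tc|ct] := ltP (t + m%:~R) c; [left|right]; split.
- have -> : Num.floor (t - c) = - m - 1; last by lia.
  by apply: floor_def; rewrite subrK rmorphB rmorphN /=; lra.
- by exists m; lra.
- by apply/esym/floor_def; rewrite rmorphD rmorphN /=; lra.
- by exists m; lra.
Qed.

Lemma floor_shift t b n :
  Num.floor (t - (b + n%:~R)) = Num.floor (t - b) - n.
Proof.
apply: floor_def; have := floor_itv (t - b).
by rewrite !rmorphD /= rmorphN /=; lra.
Qed.

(** The numbers of turns from b and from c differ exactly when a translate of t
    lies between b and c, which can be read on the cyclic order. *)
Lemma cut_cyclic I J K b c t : right_end I b -> right_end J c ->
  b <= c < b + 1 -> I `&` J = set0 -> I `&` K = set0 -> J `&` K = set0 ->
  (exists d, right_end K d) -> K (circle_pi t) ->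
  (Num.floor (t - b) = Num.floor (t - c) + 1 /\ set_cyclic_order I K J) \/
  (Num.floor (t - b) = Num.floor (t - c) /\ set_cyclic_order J K I).
Proof.
move=> [a [ab ba IE]] [e [ec ce JE]] bc IJ IK JK [d rK] Kt.
have be : b <= e.
  by have := disjoint_arcs 0 ab ec; rewrite -IE -JE addr0 => /(_ IJ) []; lra.
have ca : c <= a + 1.
  by have := disjoint_arcs 1 ab ec; rewrite -IE -JE => /(_ IJ) []; lra.
have lift m : exists k1 k2, [/\ k1 < t + m%:~R < k2, K = circle_arc k1 k2,
    forall n, b + n%:~R <= k1 \/ k2 <= a + n%:~R
  & forall n, c + n%:~R <= k1 \/ k2 <= e + n%:~R].
  have [k [kd dk KE]] := rK; move: Kt; rewrite KE => /arcP[m' tm'].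
  exists (k + (m - m')%:~R), (d + (m - m')%:~R); rewrite arc_shift.
  split=> // [|n|n]; first by rewrite rmorphB /=; lra.
  - have [||] := disjoint_arcs (n - (m - m')) ab kd; rewrite -?IE -?KE //.
      by rewrite rmorphB /=; lra.
    by rewrite rmorphB /=; lra.
  - have [||] := disjoint_arcs (n - (m - m')) ec kd; rewrite -?JE -?KE //.
      by rewrite rmorphB /=; lra.
    by rewrite rmorphB /=; lra.
case: (floor_cut t bc) => -[fl [m tm]]; [left|right]; split=> //.
  have [k1 [k2 [tk KE dI dJ]]] := lift m.
  have bk : b <= k1 by have := dI 0; rewrite !addr0; lra.
  have ke : k2 <= e by have := dJ 0; rewrite !addr0; lra.
  rewrite IE JE KE => _ _ _ [x /= xI <-] [y /= yK <-] [z /= zJ <-].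
  by exists x, y, z; split; split=> //; lra.
have [k1 [k2 [tk KE dI dJ]]] := lift m.
have ck : c <= k1 by have := dJ 0; rewrite !addr0; lra.
have ka : k2 <= a + 1 by have := dI 1; lra.
rewrite IE JE KE => _ _ _ [z /= zJ <-] [y /= yK <-] [x /= xI <-].
exists z, y, (x + 1); split; first by split; lra.
by split=> //; exact: (circle_pi_shift x 1).
Qed.

Lemma cut_left I J b c t : right_end I b -> right_end J c ->
  b <= c < b + 1 -> I `&` J = set0 -> I (circle_pi t) ->
  Num.floor (t - b) = Num.floor (t - c).
Proof.
move=> [a [ab ba ->]] [e [ec ce ->]] bc IJ /arcP[k tk].
have ca : c <= a + 1 by have := disjoint_arcs 1 ab ec IJ; lra.
case: (floor_cut t bc) => -[// _ [m tm]].
have : m - k = 0 by apply: int_eq0; rewrite rmorphB /=; lra.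
move=> /eqP; rewrite subr_eq0 => /eqP mE.
by exfalso; rewrite mE in tm; lra.
Qed.

Lemma cut_right I J b c t : right_end I b -> right_end J c ->
  b <= c < b + 1 -> I `&` J = set0 -> J (circle_pi t) ->
  Num.floor (t - b) = Num.floor (t - c) + 1.
Proof.
move=> [a [ab ba ->]] [e [ec ce ->]] bc IJ /arcP[k tk].
have be : b <= e by have := disjoint_arcs 0 ab ec IJ; rewrite !addr0; lra.
case: (floor_cut t bc) => -[// _ [m tm]].
have : m - k = 0 by apply: int_eq0; rewrite rmorphB /=; lra.
move=> /eqP; rewrite subr_eq0 => /eqP mE.
by exfalso; rewrite mE in tm; lra.
Qed.

Lemma cyclic_order_antisym (x y z : circle R) :
  cyclic_order x y z -> ~ cyclic_order z y x.
Proof.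
move=> [a [b [c [[ab bc ca] [<- <- <-]]]]] [c' [b' [a' [[cb ba ac] []]]]].
move=> /circle_piP[k ck] /circle_piP[m bm] /circle_piP[n an].
have h1 : (m - k)%:~R - 1 = 0 :> R.
  have : m - k - 1 = 0 by apply: int_eq0; rewrite rmorphB /= rmorphB /=; lra.
  by move=> /(congr1 (fun i : int => i%:~R : R)); rewrite rmorphB.
have h2 : (n - m)%:~R - 1 = 0 :> R.
  have : n - m - 1 = 0 by apply: int_eq0; rewrite rmorphB /= rmorphB /=; lra.
  by move=> /(congr1 (fun i : int => i%:~R : R)); rewrite rmorphB.
by move: h1 h2; rewrite !rmorphB /=; lra.
Qed.

End Arcs.

Section Families.
Variable R : realType.
Variables (II II' : set (set (circle R))) (theta : set (circle R) -> set (circle R)).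

Definition disjoint_arcs_family (F : set (set (circle R))) :=
  (forall I, F I -> exists b, right_end I b) /\
  forall I J, F I -> F J -> I `&` J !=set0 -> I = J.

Hypotheses (HII : disjoint_arcs_family II) (HII' : disjoint_arcs_family II').
Hypothesis theta_bij : set_bij II II' theta.
Hypothesis theta_cyclic : forall I1 I2 I3, II I1 -> II I2 -> II I3 ->
  set_cyclic_order I1 I2 I3 ->
  set_cyclic_order (theta I1) (theta I2) (theta I3).

Implicit Types (b c t : R) (I J K : set (circle R)).

Lemma theta_in I : II I -> II' (theta I).
Proof. by case: theta_bij => + _ _; apply. Qed.

Lemma theta_inj I J : II I -> II J -> theta I = theta J -> I = J.
Proof. by move=> /mem_set iI /mem_set jJ; case: theta_bij => _ + _; apply. Qed.

Lemma family_disjoint F I J : disjoint_arcs_family F -> F I -> F J -> I <> J ->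
  I `&` J = set0.
Proof.
move=> [_ dF] FI FJ IJ; apply/eqP/negPn/negP => /set0P /(dF _ _ FI FJ).
exact: IJ.
Qed.

Definition corresponding (x x' : circle R) :=
  exists I, [/\ II I, I x & theta I x'].

Definition corresponding_cuts b b' :=
  exists I, [/\ II I, right_end I b & right_end (theta I) b'].

Lemma cuts_shift b b' n n' : corresponding_cuts b b' ->
  corresponding_cuts (b + n%:~R) (b' + n'%:~R).
Proof.
by move=> [I [IIi r r']]; exists I; split=> //; exact: right_end_shift.
Qed.

Lemma cuts_change_normal b b' c c' t t' :
  corresponding_cuts b b' -> corresponding_cuts c c' ->
  b <= c < b + 1 -> b' <= c' < b' + 1 ->
  corresponding (circle_pi t) (circle_pi t') ->
  Num.floor (t - b) - Num.floor (t - c) =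
  Num.floor (t' - b') - Num.floor (t' - c').
Proof.
move=> [I [iI rb rb']] [J [iJ rc rc']] bc bc' [K [iK Kt Kt']].
have [IJ|IJ] := pselect (I = J).
  have e0 x y (L : set (circle R)) : x <= y < x + 1 ->
      right_end L x -> right_end L y -> y = x.
    move=> xy rx ry; have [n yn] := right_end_unique rx ry.
    by have n0 : n = 0 by [apply: int_eq0; lra]; rewrite yn n0 addr0.
  rewrite -IJ in rc rc'.
  by rewrite (e0 _ _ _ bc rb rc) (e0 _ _ _ bc' rb' rc') !subrr.
have dIJ := family_disjoint HII iI iJ IJ.
have dIJ' : theta I `&` theta J = set0.
  by apply: family_disjoint HII' _ _ _; [exact: theta_in|exact: theta_in|
    move=> /(theta_inj iI iJ)].
have [KI|KI] := pselect (K = I).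
  rewrite KI in Kt Kt'.
  by rewrite (cut_left rb rc bc) // (cut_left rb' rc' bc') // !subrr.
have [KJ|KJ] := pselect (K = J).
  rewrite KJ in Kt Kt'.
  rewrite (cut_right rb rc bc) // (cut_right rb' rc' bc') //; lia.
have dis L : II L -> K <> L -> L `&` K = set0 /\ theta L `&` theta K = set0.
  move=> iL KL; split; first by apply: family_disjoint HII _ _ _ => // /esym.
  by apply: family_disjoint HII' _ _ _; [exact: theta_in|exact: theta_in|
    move=> /(theta_inj iL iK)/esym].
have [dI dI'] := dis _ iI KI; have [dJ dJ'] := dis _ iJ KJ.
have rK := HII.1 _ iK; have rK' := HII'.1 _ (theta_in iK).
have [x Ix] := right_end_nonempty rb'; have [y Jy] := right_end_nonempty rc'.
have [[-> cy]|[-> cy]] := cut_cyclic rb rc bc dIJ dI dJ rK Kt;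
  have cy' := theta_cyclic _ _ _ cy;
  have [[-> cy2]|[-> cy2]] := cut_cyclic rb' rc' bc' dIJ' dI' dJ' rK' Kt';
  try lia; exfalso.
  exact: cyclic_order_antisym (cy' iI iK iJ _ _ _ Ix Kt' Jy) (cy2 _ _ _ Jy Kt' Ix).
exact: cyclic_order_antisym (cy' iJ iK iI _ _ _ Jy Kt' Ix) (cy2 _ _ _ Ix Kt' Jy).
Qed.

(** On each circle, the difference between the numbers of turns from two cuts is
    read on the cyclic order, which theta preserves; the constant q only depends
    on the lifts of the cuts. *)
Lemma cuts_change b b' c c' :
  corresponding_cuts b b' -> corresponding_cuts c c' ->
  exists q : int, forall t t', corresponding (circle_pi t) (circle_pi t') ->
  Num.floor (t - b) - Num.floor (t' - b') =
  Num.floor (t - c) - Num.floor (t' - c') + q.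
Proof.
move=> cb cc; have [n cn] := translate_in b c; have [n' cn'] := translate_in b' c'.
exists (n' - n) => t t' tt'.
have := cuts_change_normal cb (cuts_shift n n' cc) cn cn' tt'.
by rewrite !floor_shift; lia.
Qed.

Definition matched b b' t t' := corresponding (circle_pi t) (circle_pi t') /\
  Num.floor (t - b) = Num.floor (t' - b').

End Families.

(** * Lifts of circle homeomorphisms *)

Section Lifts.
Variable R : realType.
Implicit Types (F : R -> R) (f : circle R -> circle R) (I : set (circle R)).

Lemma HomeoZ_mono F : HomeoZ F -> {mono F : x y / x < y}.
Proof.
move=> [[cF [Fi [_ FK _]]] tF].
have F1 x : F (x + 1) = F x + 1 by exact: (tF x 1).
have cF' : {within [set` `]-oo, +oo[%R], continuous F}.
  exact: continuous_subspaceT.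
have iF : {in `]-oo, +oo[%R &, injective F}.
  by move=> x y _ _; exact: (can_inj FK).
have [h|h] := itv_continuous_inj_mono cF' iF.
  apply: leW_mono; apply: le_mono => x y; apply: h; exact: in_itv.
have := h 1 0; rewrite !in_itv /= => /(_ isT isT ltr01).
by rewrite -[1]add0r F1; lra.
Qed.

Lemma HomeoZ_le F : HomeoZ F -> {mono F : x y / x <= y}.
Proof. by move=> HF x y; rewrite !leNgt HomeoZ_mono. Qed.

Lemma HomeoZ_inv F : HomeoZ F ->
  exists Fi, [/\ HomeoZ Fi, cancel F Fi & cancel Fi F].
Proof.
move=> [[cF [Fi [cFi FK FiK]]] tF]; exists Fi; split=> //; split.
  by split=> //; exists F.
by move=> x n; apply: (can_inj FK); rewrite tF !FiK.
Qed.

Lemma HomeoZ_id : HomeoZ (@id R).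
Proof. by split=> //; split; [move=> x|exists id; split=> // x]. Qed.

Lemma HomeoZ_comp F1 F2 : HomeoZ F1 -> HomeoZ F2 -> HomeoZ (F1 \o F2).
Proof.
move=> [[c1 [G1 [d1 K1 L1]]] t1] [[c2 [G2 [d2 K2 L2]]] t2]; split.
  split; first by move=> x; apply: continuous_comp; [exact: c2|exact: c1].
  exists (G2 \o G1); split; last 2 first.
  - exact: can_comp.
  - exact: can_comp.
  by move=> x; apply: continuous_comp; [exact: d1|exact: d2].
by move=> x n /=; rewrite t2 t1.
Qed.

Lemma HomeoZ_shift F (n : int) : HomeoZ F -> HomeoZ (fun x => F x + n%:~R).
Proof.
have sh (m : int) : HomeoZ (fun x : R => x + m%:~R).
  have ct (k : int) : continuous (fun x : R => x + k%:~R).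
    by move=> x; apply: cvgD; [exact: cvg_id|exact: cvg_cst].
  split; last by move=> x k; rewrite addrAC.
  split; first exact: ct.
  exists (fun x => x + (- m)%:~R); split; first exact: ct.
    by move=> x; rewrite rmorphN /= addrK.
  by move=> x; rewrite rmorphN /= subrK.
by move=> HF; exact: (HomeoZ_comp (sh n) HF).
Qed.

Lemma lifts_inv F f Fi fi : lifts F f -> cancel Fi F -> cancel f fi ->
  lifts Fi fi.
Proof. by move=> lF FiK fK x; rewrite -{2}(FiK x) lF fK. Qed.

Lemma lifts_shift F f (n : int) : lifts F f -> lifts (fun x => F x + n%:~R) f.
Proof. by move=> lF x; rewrite circle_pi_shift. Qed.

Lemma floor_HomeoZ F t b : HomeoZ F ->
  Num.floor (F t - F b) = Num.floor (t - b).
Proof.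
move=> HF; have [_ tF] := HF; apply: floor_def; have := floor_itv (t - b).
move: (Num.floor _) => n; have := HomeoZ_le HF (b + n%:~R) t.
have := HomeoZ_mono HF t (b + (n + 1)%:~R); rewrite !tF.
by rewrite !lerBrDl !ltrBlDl => -> ->.
Qed.

Lemma right_end_image F f I b : HomeoZ F -> lifts F f ->
  right_end I b -> right_end (f @` I) (F b).
Proof.
move=> HF lF [a [ab ba ->]]; exists (F a); split.
- by rewrite HomeoZ_mono.
- by have := HF.2 a 1 => /= <-; rewrite HomeoZ_le.
have [Fi [HFi FK FiK]] := HomeoZ_inv HF.
apply/seteqP; split=> z.
  move=> [_ [t tab <-] <-]; exists (F t); last by rewrite lF.
  by rewrite /= !HomeoZ_mono.
move=> [t /= tab <-]; exists (circle_pi (Fi t)); last by rewrite -lF FiK.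
by exists (Fi t) => //=; rewrite -(HomeoZ_mono HF a) -(HomeoZ_mono HF _ b) FiK.
Qed.

End Lifts.

Section Gaps.
Variable R : realType.
Variable II : set (set (circle R)).

Lemma gap_connected J : gaps II J -> connected J.
Proof. by move=> [x _ <-]; exact: component_connected. Qed.

Lemma gap_disjoint I J : II I -> gaps II J -> J `&` I = set0.
Proof.
move=> iI [x _ <-]; apply/seteqP; split=> // y [/connected_component_sub ny Iy].
by apply: ny; exists I.
Qed.

Lemma gap_closed J : (forall I, II I -> open I) -> gaps II J -> closed J.
Proof.
move=> oI [x _ <-]; apply: component_closed; apply: open_closedC.
exact: bigcup_open.
Qed.

End Gaps.

(** * Markovian images *)

Section Markov.
Variable R : realType.
Variables (II II' : set (set (circle R))) (theta : set (circle R) -> set (circle R)).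
Hypotheses (HII : disjoint_arcs_family II) (HII' : disjoint_arcs_family II').
Hypothesis theta_bij : set_bij II II' theta.
Implicit Types (F : R -> R) (f : circle R -> circle R) (I J : set (circle R)).

Lemma right_end_outside (L : set (set (circle R))) I K (b : R) :
  disjoint_arcs_family L -> L I -> L K -> right_end I b -> ~ K (circle_pi b).
Proof.
move=> HL LI LK rb Kb; have [IK|IK] := pselect (I = K).
  by apply: (right_end_notin rb); rewrite IK.
have := family_disjoint HL LI LK IK; have [d [k [kd dk KE]]] := HL.1 _ LK.
have [a [ab ba IE]] := rb; rewrite IE KE => dis.
move: Kb; rewrite KE => /arcP[n bn].
by have := disjoint_arcs n ab kd dis; lra.
Qed.

Lemma family_open (L : set (set (circle R))) I :
  disjoint_arcs_family L -> L I -> open I.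
Proof. by move=> HL /(HL.1)[b [a [_ _ ->]]]; exact: open_arc. Qed.

(** A Markovian image ends with an interval of the family, and the gap after
    this interval is not covered. As the correspondence of gaps is determined
    by the preceding interval, the corresponding Markovian image ends with the
    corresponding interval. *)
Lemma markovian_cuts f F f' F' I b b' (m : nat) (Is : 'I_m.+1 -> set (circle R))
    (Js Js' : 'I_m -> set (circle R)) :
  HomeoZ F -> lifts F f -> HomeoZ F' -> lifts F' f' ->
  right_end I b -> right_end (theta I) b' ->
  markovian_decomposition II (f @` I) Is Js ->
  (forall j, gap_correspondence II II' theta (Js j) (Js' j)) ->
  markovian_decomposition II' (f' @` theta I) (theta \o Is) Js' ->
  corresponding_cuts II theta (F b) (F' b').
Proof.
move=> HF lF HF' lF' rb rb' [_ iIs gJs fI] gc [_ iIs' gJs' fI'].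
have rF := right_end_image HF lF rb; have rF' := right_end_image HF' lF' rb'.
have [i ri] : exists i, right_end (Is i) (F b).
  have [p [pF Fp fIE]] := rF; apply: (last_arc pF Fp).
  - by move=> i; exact: HII.1.
  - by move=> j; apply: gap_closed (gJs j) => J; exact: family_open.
  - by rewrite -fIE.
have [p [pF Fp fIE]] := rF'.
have [i' ri'] : exists i', right_end (theta (Is i')) (F' b').
  apply: (last_arc (Is := theta \o Is) (Js := Js') pF Fp).
  - by move=> i'; exact: HII'.1.
  - by move=> j; apply: gap_closed (gJs' j) => J; exact: family_open.
  - by rewrite -fIE.
have [ii|ii] := pselect (Is i = Is i').
  by exists (Is i); split=> //; rewrite ii.
exfalso; have iti : II' (theta (Is i)) by exact: (theta_in theta_bij).
have itj : II' (theta (Is i')) by exact: (theta_in theta_bij).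
have dis : theta (Is i') `&` theta (Is i) = set0.
  apply: (family_disjoint HII') => //.
  by move=> /(theta_inj theta_bij (iIs i') (iIs i)) /esym.
have [d0 rd] := HII'.1 _ iti.
have {rd} [d cd rd] : exists2 d, F' b' <= d < F' b' + 1 & right_end (theta (Is i)) d.
  have [n dn] := translate_in (F' b') d0; exists (d0 + n%:~R) => //.
  exact: right_end_shift.
(* The right end of theta (Is i) would be interior to the image, hence would
   belong to one of its gaps. *)
have : (f' @` theta I) (circle_pi d).
  rewrite fIE; apply/arcP; exists (-1).
  have [e [ed de tE]] := rd; have [k [kF Fk tE']] := ri'.
  have dis' := dis; rewrite tE tE' in dis'.
  have ce : F' b' <= e by have := disjoint_arcs 0 kF ed dis'; rewrite !addr0; lra.
  have dk : d <= k + 1 by have := disjoint_arcs 1 kF ed dis'; lra.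
  have : circle_arc p (F' b') (circle_pi ((e + d) / 2)).
    rewrite -fIE fI'; left; exists i => //=; rewrite tE.
    exact: arc_nonempty.
  move=> /arcP[n en]; have : (n + 1)%:~R <= 0 :> R.
    by apply: int_le0; rewrite rmorphD /=; lra.
  have : 0 <= (n + 1)%:~R :> R by apply: int_ge0; rewrite rmorphD /=; lra.
  by rewrite rmorphD rmorphN /=; lra.
rewrite fI' => -[[k _ /=]|[k _ Jd]].
  by apply: right_end_outside HII' _ _ rd => //; exact: (theta_in theta_bij).
(* The interval K before this gap can only be Is i, and then the gap on the other
   side contains the right end of the first image. *)
have [gk gk' [K [iK nK nK']]] := gc k.
have [a2 [b2 [ab2 ba2 KE Kb2]]] := nK'.
have rb2 : right_end (theta K) b2 by exists a2.
have [KI|KI] := pselect (K = Is i); last first.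
  apply: (right_ends_separated rb2 rd _ (gap_connected gk')) => //.
  - apply: (family_disjoint HII') => //; first exact: (theta_in theta_bij).
    by move=> /(theta_inj theta_bij iK (iIs i)).
  - by apply: gap_disjoint gk'; exact: (theta_in theta_bij).
  - exact: gap_disjoint gk'.
have [a1 [b1 [ab1 ba1 KE1 Kb1]]] := nK; rewrite KI in KE1.
have [n bn] : exists n : int, F b = b1 + n%:~R.
  by apply: right_end_unique ri; exists a1.
apply: (right_end_notin rF); rewrite fI bn circle_pi_shift.
by right; exists k.
Qed.

(** The numbers of turns from the cuts at b and b' become the numbers of turns
    from the cuts at F b and F' b', and a change of cuts modifies their
    difference by a constant, which is absorbed in the choice of F'. *)
Lemma cuts_matched f F f' F' b b' beta beta' :
  (forall I1 I2 I3, II I1 -> II I2 -> II I3 ->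
    set_cyclic_order I1 I2 I3 ->
    set_cyclic_order (theta I1) (theta I2) (theta I3)) ->
  HomeoZ F -> lifts F f -> HomeoZ F' -> lifts F' f' ->
  corresponding_cuts II theta beta beta' -> corresponding_cuts II theta b b' ->
  corresponding_cuts II theta (F b) (F' b') ->
  exists q : int, forall t t',
    matched II theta beta beta' t t' ->
    corresponding II theta (f (circle_pi t)) (f' (circle_pi t')) ->
    matched II theta beta beta' (F t) (F' t' + q%:~R).
Proof.
move=> cyc HF lF HF' lF' cbeta cb cF.
have [q1 Q1] := cuts_change HII HII' theta_bij cyc cb cbeta.
have [q2 Q2] := cuts_change HII HII' theta_bij cyc cF cbeta.
exists (q1 - q2) => t t' [tt' fl] ftt'.
have tF : corresponding II theta (circle_pi (F t)) (circle_pi (F' t')).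
  by rewrite lF lF'.
split; first by rewrite circle_pi_shift.
have := Q2 _ _ tF; rewrite !floor_HomeoZ // Q1 // fl.
have -> : F' t' + (q1 - q2)%:~R - beta' = F' t' - (beta' + (q2 - q1)%:~R).
  by rewrite !rmorphB /=; lra.
by rewrite floor_shift; lia.
Qed.

End Markov.

(** * Matched lifts and semi-conjugacy *)

Section Matching.
Variables (R : realType) (G : groupType) (rho rho' : G -> circle R -> circle R).
Hypotheses (Hrho : circle_representation rho) (Hrho' : circle_representation rho').
(* Y is a correspondence between the points of the two circles, and M selects
   among the lifts of two corresponding points those that have made the same
   number of turns. *)
Variables (Y : circle R -> circle R -> Prop) (M : R -> R -> Prop) (C : R).
Hypothesis Y_M : forall t t', Y (circle_pi t) (circle_pi t') ->
  exists n : int, M t (t' + n%:~R).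
Hypothesis M_shift : forall t t' (n m : int), M t t' ->
  M (t + n%:~R) (t' + m%:~R) <-> n = m.
Hypothesis M_bound : forall t t', M t t' -> `|t - t'| <= C.
Hypothesis Y_orbit : forall K : seq G, exists x x', forall k, k \in K ->
  Y (rho k x) (rho' k x').

Implicit Types (F : R -> R) (g : G) (t x : R).

Definition deep (K : seq G) t t' := M t t' /\ forall k, k \in K ->
  Y (rho k (circle_pi t)) (rho' k (circle_pi t')).

(** The pairs on which M has to be preserved may be restricted to those whose
    translates by a finite set K correspond. This restriction makes the notion
    stable under composition and inversion. *)
Definition matched_lifts g F F' :=
  [/\ HomeoZ F, lifts F (rho g), HomeoZ F', lifts F' (rho' g)
    & exists K, forall t t', deep K t t' -> M (F t) (F' t')].

Lemma deep_exists K : exists t t', deep K t t'.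
Proof.
have [x [x' xx']] := Y_orbit (1%g :: K).
have [t tx] := circle_pi_surj x; have [t' tx'] := circle_pi_surj x'.
rewrite -{}tx -{}tx' in xx'.
have := xx' _ (mem_head _ _); rewrite Hrho.1.1 Hrho'.1.1 => /Y_M[n Mn].
exists t, (t' + n%:~R); split=> // k kK; rewrite circle_pi_shift.
by apply: xx'; rewrite inE kK orbT.
Qed.

Lemma matched_lifts1 (n : int) :
  matched_lifts 1%g (fun x => x + n%:~R) (fun x => x + n%:~R).
Proof.
have sh : HomeoZ (fun x : R => x + n%:~R) := HomeoZ_shift n (HomeoZ_id R).
have l1 (r : G -> circle R -> circle R) : circle_representation r ->
    lifts (fun x => x + n%:~R) (r 1%g).
  by move=> Hr x; rewrite circle_pi_shift Hr.1.1.
split=> //; [exact: l1|exact: l1|exists [::] => t t' [Mt _]].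
exact/M_shift.
Qed.

Lemma matched_liftsM g1 g2 F1 F1' F2 F2' :
  matched_lifts g1 F1 F1' -> matched_lifts g2 F2 F2' ->
  matched_lifts (g1 * g2)%g (F1 \o F2) (F1' \o F2').
Proof.
move=> [H1 l1 H1' l1' [K1 P1]] [H2 l2 H2' l2' [K2 P2]]; split.
- exact: HomeoZ_comp.
- by move=> x /=; rewrite l1 l2 Hrho.1.2.
- exact: HomeoZ_comp.
- by move=> x /=; rewrite l1' l2' Hrho'.1.2.
exists (K2 ++ [seq (k * g2)%g | k <- K1]) => t t' [Mt Kt]; apply: P1; split.
  by apply: P2; split=> // k kK; apply: Kt; rewrite mem_cat kK.
move=> k kK; rewrite l2 l2' -Hrho.1.2 -Hrho'.1.2; apply: Kt.
by rewrite mem_cat; apply/orP; right; apply/mapP; exists k.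
Qed.

Lemma representationK (r : G -> circle R -> circle R) g :
  circle_representation r -> cancel (r g) (r g^-1%g).
Proof. by move=> [[r1 rM] _] x; rewrite -rM mulVg r1. Qed.

(** Over the images of t and t', some translate of one point is matched with the
    other; applying F and F' shows that this translate is trivial. *)
Lemma matched_liftsV g F F' Fi Fi' :
  cancel F Fi -> cancel Fi F -> cancel F' Fi' -> cancel Fi' F' ->
  HomeoZ Fi -> HomeoZ Fi' ->
  matched_lifts g F F' -> matched_lifts g^-1%g Fi Fi'.
Proof.
move=> FK FiK FK' FiK' HFi HFi' [HF lF HF' lF' [K P]].
have lFi : lifts Fi (rho g^-1%g) by apply: lifts_inv lF FiK (representationK g Hrho).
have lFi' : lifts Fi' (rho' g^-1%g).
  by apply: lifts_inv lF' FiK' (representationK g Hrho').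
split=> //; exists (g^-1%g :: [seq (k * g^-1)%g | k <- K]) => t t' [Mt Kt].
have : Y (circle_pi (Fi t)) (circle_pi (Fi' t')).
  by rewrite lFi lFi'; apply: Kt; rewrite mem_head.
move=> /Y_M[n Mn].
have : M (F (Fi t)) (F' (Fi' t' + n%:~R)).
  apply: P; split=> // k kK; rewrite circle_pi_shift lFi lFi'.
  rewrite -Hrho.1.2 -Hrho'.1.2; apply: Kt; rewrite inE.
  by apply/orP; right; apply/mapP; exists k.
rewrite HF'.2 FiK FiK' => Mtn.
have n0 : 0 = n by apply/(@M_shift t t' 0 n Mt); rewrite addr0.
by rewrite -n0 addr0 in Mn.
Qed.

Lemma matched_lifts_unique (n m : int) :
  matched_lifts 1%g (fun x => x + n%:~R) (fun x => x + m%:~R) -> n = m.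
Proof.
move=> [_ _ _ _ [K P]]; have [t [t' tt']] := deep_exists K.
by have := P _ _ tt' => /M_shift; apply; case: tt'.
Qed.

(** The displacement of F is an integer at every point; over an interval of length
    one, monotonicity leaves no room for two different values. *)
Lemma HomeoZ_lift1 F : HomeoZ F -> lifts F id ->
  exists n : int, forall x, F x = x + n%:~R.
Proof.
move=> HF lF; have /circle_piP[n Fn] := lF 0; exists n => x.
have [k xk] := translate_in 0 x.
have /circle_piP[m Fm] := lF (x + k%:~R).
have mn : m - n = 0.
  apply: int_eq0; rewrite rmorphB /=.
    by have := HomeoZ_le HF 0 (x + k%:~R); rewrite Fn Fm; lra.
  by have := HomeoZ_mono HF (x + k%:~R) (0 + 1%:~R); rewrite (HF.2 0 1) Fn Fm; lra.
have mE : m = n by apply/eqP; rewrite -subr_eq0 mn.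
by move: Fm; rewrite mE HF.2; lra.
Qed.

(** At a deep pair of points, both the points and their images are at distance at
    most C; a map that commutes with integer translations is determined up to a
    bounded error by one of its values. *)
Lemma matched_lifts_bound :
  exists c : int, forall g F F', matched_lifts g F F' -> forall x,
    `|F x - F' x| <= c%:~R.
Proof.
(* An integer bound, so that it can be moved across F and F'. *)
pose c := Num.ceil C; have Cc : C <= c%:~R by exact: ceil_ge.
exists (c + c + 2) => g F F' [HF _ HF' _ [K P]] x.
have [t [t' tt']] := deep_exists K.
have := M_bound (P _ _ tt'); have := M_bound tt'.1; rewrite !ler_norml => bt bF.
have [n xn] := translate_in t x.
have F1 := HomeoZ_le HF t (x + n%:~R).
have F2 := HomeoZ_mono HF (x + n%:~R) (t + 1%:~R).
have F1' := HomeoZ_le HF' (t' + (- c)%:~R) (x + n%:~R).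
have F2' := HomeoZ_mono HF' (x + n%:~R) (t' + (c + 1)%:~R).
rewrite !HF.2 in F1 F2; rewrite !HF'.2 !rmorphD !rmorphN /= in F1' F2'.
rewrite !rmorphD /=; lra.
Qed.

(** The elements of the central extension are those of G together with matched
    lifts of their two actions. The inverses of the lifts are recorded, so that
    the group operations are given by explicit formulas. *)
Definition is_matched (p : G * ((R -> R) * (R -> R)) * ((R -> R) * (R -> R))) :=
  matched_lifts p.1.1 p.1.2.1 p.2.1 /\
  [/\ (HomeoZ p.1.2.2 /\ HomeoZ p.2.2),
      cancel p.1.2.1 p.1.2.2, cancel p.1.2.2 p.1.2.1,
      cancel p.2.1 p.2.2 & cancel p.2.2 p.2.1].

Definition matched_bool p : bool := `[< is_matched p >].
Definition extension := {p | matched_bool p}.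
HB.instance Definition _ := Choice.on extension.

Implicit Types (e k : extension).

Definition proj e : G := (val e).1.1.
Definition lift1 e : R -> R := (val e).1.2.1.
Definition lift1V e : R -> R := (val e).1.2.2.
Definition lift2 e : R -> R := (val e).2.1.
Definition lift2V e : R -> R := (val e).2.2.

Lemma extensionP e : matched_lifts (proj e) (lift1 e) (lift2 e) /\
  [/\ (HomeoZ (lift1V e) /\ HomeoZ (lift2V e)),
      cancel (lift1 e) (lift1V e), cancel (lift1V e) (lift1 e),
      cancel (lift2 e) (lift2V e) & cancel (lift2V e) (lift2 e)].
Proof. by case: e => p pP; exact/asboolP. Qed.

Lemma matched_mul e k : matched_bool (proj e * proj k,
  (lift1 e \o lift1 k, lift1V k \o lift1V e),
  (lift2 e \o lift2 k, lift2V k \o lift2V e))%g.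
Proof.
have [m1 [[h1 h1'] c1 c1' d1 d1']] := extensionP e.
have [m2 [[h2 h2'] c2 c2' d2 d2']] := extensionP k.
apply/asboolP; split=> /=; first exact: matched_liftsM.
by split; try exact: can_comp; split; exact: HomeoZ_comp.
Qed.

Lemma matched_inv e : matched_bool ((proj e)^-1,
  (lift1V e, lift1 e), (lift2V e, lift2 e))%g.
Proof.
have [m1 [[h1 h1'] c1 c1' d1 d1']] := extensionP e.
apply/asboolP; split=> /=; first exact: matched_liftsV m1.
by split=> //; split; case: m1.
Qed.

Lemma matched_translation (n : int) : matched_bool (1%g,
  ((fun x => x + n%:~R), (fun x => x + (- n)%:~R)),
  ((fun x => x + n%:~R), (fun x => x + (- n)%:~R))).
Proof.
apply/asboolP; split=> /=; first exact: matched_lifts1.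
have sh (m : int) : HomeoZ (fun x : R => x + m%:~R).
  exact: HomeoZ_shift (HomeoZ_id R).
by split=> //; move=> x; rewrite rmorphN /= ?addrK ?subrK.
Qed.

Definition translation (n : int) : extension := exist matched_bool _ (matched_translation n).
Definition extension_mul e k : extension := exist matched_bool _ (matched_mul e k).
Definition extension_inv e : extension := exist matched_bool _ (matched_inv e).

Lemma extension_eq e k : proj e = proj k -> lift1 e =1 lift1 k ->
  lift1V e =1 lift1V k -> lift2 e =1 lift2 k -> lift2V e =1 lift2V k -> e = k.
Proof.
move=> p1 /funext p2 /funext p3 /funext p4 /funext p5; apply: val_inj.
move: p1 p2 p3 p4 p5; rewrite /proj /lift1 /lift1V /lift2 /lift2V.
by move: (val e) (val k) => [[? [? ?]] [? ?]] [[? [? ?]] [? ?]] /= -> -> -> -> ->.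
Qed.

Lemma translation_lifts (n : int) x :
  (lift1 (translation n) x = x + n%:~R) * (lift1V (translation n) x = x - n%:~R) *
  (lift2 (translation n) x = x + n%:~R) * (lift2V (translation n) x = x - n%:~R).
Proof. by rewrite -rmorphN. Qed.

Lemma mul_lifts e k x :
  (lift1 (extension_mul e k) x = lift1 e (lift1 k x)) *
  (lift1V (extension_mul e k) x = lift1V k (lift1V e x)) *
  (lift2 (extension_mul e k) x = lift2 e (lift2 k x)) *
  (lift2V (extension_mul e k) x = lift2V k (lift2V e x)).
Proof. by []. Qed.

Lemma extension_mulA : associative extension_mul.
Proof. by move=> e k l; apply: extension_eq => //; exact: mulgA. Qed.

Lemma extension_mul1 : left_id (translation 0) extension_mul.
Proof.
move=> e; apply: extension_eq.
- exact: mul1g.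
all: by move=> x; rewrite mul_lifts translation_lifts ?subr0 ?addr0.
Qed.

Lemma extension_mul1r : right_id (translation 0) extension_mul.
Proof.
move=> e; apply: extension_eq.
- exact: mulg1.
all: by move=> x; rewrite mul_lifts translation_lifts ?subr0 ?addr0.
Qed.

Lemma extension_mulV : left_inverse (translation 0) extension_inv extension_mul.
Proof.
move=> e; have [_ [_ c1 c1' d1 d1']] := extensionP e; apply: extension_eq.
- exact: mulVg.
- by move=> x; rewrite [RHS]addr0; exact: c1.
- by move=> x; rewrite [RHS]addr0; exact: c1.
- by move=> x; rewrite [RHS]addr0; exact: d1.
- by move=> x; rewrite [RHS]addr0; exact: d1.
Qed.

Lemma extension_mulVr : right_inverse (translation 0) extension_inv extension_mul.
Proof.
move=> e; have [_ [_ c1 c1' d1 d1']] := extensionP e; apply: extension_eq.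
- exact: mulgV.
- by move=> x; rewrite [RHS]addr0; exact: c1'.
- by move=> x; rewrite [RHS]addr0; exact: c1'.
- by move=> x; rewrite [RHS]addr0; exact: d1'.
- by move=> x; rewrite [RHS]addr0; exact: d1'.
Qed.

HB.instance Definition _ := isGroup.Build extension extension_mulA
  extension_mul1 extension_mul1r extension_mulV extension_mulVr.

Variable B : set G.
Hypothesis B_generates : forall H : set G, H 1%g ->
  (forall g h, H g -> H h -> H (g * h)%g) -> B `<=` H -> forall g, H g.
Hypothesis B_matched : forall g, B g -> exists F F',
  [/\ HomeoZ F, lifts F (rho g), HomeoZ F', lifts F' (rho' g)
    & forall t t', M t t' -> Y (rho g (circle_pi t)) (rho' g (circle_pi t')) ->
        M (F t) (F' t')].

Lemma matched_lifts_exist g : exists F F', matched_lifts g F F'.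
Proof.
apply: (@B_generates [set g | exists F F', matched_lifts g F F']) => {g}.
- by exists (fun x => x + 0%:~R), (fun x => x + 0%:~R); exact: matched_lifts1.
- move=> g h [F [F' m1]] [H [H' m2]].
  by exists (F \o H), (F' \o H'); exact: matched_liftsM.
- move=> g /B_matched[F [F' [HF lF HF' lF' FM]]]; exists F, F'; split=> //.
  exists [:: g] => t t' [Mt Kt]; apply: FM => //.
  by apply: Kt; rewrite mem_head.
Qed.

Lemma extension_central : central_extension translation proj.
Proof.
split.
- move=> m n; apply: extension_eq.
  + by rewrite [RHS]mulg1.
  + by move=> x; rewrite mul_lifts !translation_lifts rmorphD /=; lra.
  + by move=> x; rewrite mul_lifts !translation_lifts rmorphD /=; lra.
  + by move=> x; rewrite mul_lifts !translation_lifts rmorphD /=; lra.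
  + by move=> x; rewrite mul_lifts !translation_lifts rmorphD /=; lra.
- by move=> m n /(congr1 (lift1^~ 0)) /=; rewrite /lift1 /= !add0r => /intr_inj.
- move=> n e; have [[h1 _ h2 _ _] [[h1' h2'] _ _ _ _]] := extensionP e.
  apply: extension_eq.
  + by rewrite /proj /= mul1g mulg1.
  + by move=> x; rewrite [RHS](h1.2 x n).
  + by move=> x; rewrite [LHS](h1'.2 x (- n)).
  + by move=> x; rewrite [RHS](h2.2 x n).
  + by move=> x; rewrite [LHS](h2'.2 x (- n)).
split=> // [g|e].
  have [F [F' m]] := matched_lifts_exist g; have [HF _ HF' _ _] := m.
  have [Fi [HFi FK FiK]] := HomeoZ_inv HF.
  have [Fi' [HFi' FK' FiK']] := HomeoZ_inv HF'.
  have mP : matched_bool (g, (F, Fi), (F', Fi')) by apply/asboolP.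
  by exists (exist matched_bool _ mP).
split=> [e1|[n ->] //].
have [m [[h1 h2] c1 c1' d1 d1']] := extensionP e.
have [HF lF HF' lF' _] := m; rewrite e1 in m lF lF'.
have rho1 (r : G -> circle R -> circle R) : circle_representation r -> r 1%g = id.
  by move=> [[r1 _] _]; apply/funext.
rewrite rho1 // in lF; rewrite rho1 // in lF'.
have [n /funext Fn] := HomeoZ_lift1 HF lF.
have [n' /funext Fn'] := HomeoZ_lift1 HF' lF'.
rewrite Fn Fn' in m; have nn' := matched_lifts_unique m.
exists n; apply: extension_eq => //.
- by rewrite Fn.
- by move=> x; apply: (can_inj c1); rewrite c1' Fn translation_lifts subrK.
- by rewrite Fn' -nn'.
- by move=> x; apply: (can_inj d1); rewrite d1' Fn' -nn' translation_lifts subrK.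
Qed.

Lemma extension_lift1 : central_lift translation proj rho lift1.
Proof.
split=> [|e|e|t //]; [split=> // x|..]; last 2 first.
- by have [[]] := extensionP e.
- by have [[]] := extensionP e.
exact: addr0.
Qed.

Lemma extension_lift2 : central_lift translation proj rho' lift2.
Proof.
split=> [|e|e|t //]; [split=> // x|..]; last 2 first.
- by have [[]] := extensionP e.
- by have [[]] := extensionP e.
exact: addr0.
Qed.

Definition candidates x : set R := [set lift2V e (lift1 e x) | e in [set: extension]].
Definition semiconj x : R := sup (candidates x).

Lemma candidates_bounded x : has_sup (candidates x).
Proof.
split; first by exists (lift2V 1%g (lift1 1%g x)), 1%g.
have [c cP] := matched_lifts_bound.
exists (x + c%:~R) => _ [e _ <-].
have [m [[_ h2] _ _ _ d2]] := extensionP e; have [_ _ HF' _ _] := m.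
rewrite -(HomeoZ_le HF') d2 HF'.2.
by have := cP _ _ _ m x; rewrite ler_norml; lra.
Qed.

Lemma semiconj_ub x e : lift2V e (lift1 e x) <= semiconj x.
Proof.
by apply: ub_le_sup; [exact: (candidates_bounded x).2|exists e].
Qed.

Lemma semiconj_le x u : (forall e, lift2V e (lift1 e x) <= u) -> semiconj x <= u.
Proof.
move=> ub; apply: ge_sup; first exact: (candidates_bounded x).1.
by move=> _ [e _ <-].
Qed.

(** Translating the argument of semiconj by an element of the extension permutes
    the terms of the supremum up to the action on the target, and the uniform
    bound on the distance between matched lifts makes the supremum finite. *)
Theorem matching_semi_conjugate : semi_conjugate rho rho'.
Proof.
exists semiconj, extension, translation, proj, lift1, lift2; split.
- split=> [x y xy|].
    apply: semiconj_le => e; apply: le_trans (semiconj_ub y e).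
    have [[HF _ _ _ _] [[_ h2] _ _ _ _]] := extensionP e.
    by rewrite (HomeoZ_le h2) (HomeoZ_le HF).
  have le_n x (n : int) : semiconj (x + n%:~R) <= semiconj x + n%:~R.
    apply: semiconj_le => e.
    have [[HF _ _ _ _] [[_ h2] _ _ _ _]] := extensionP e.
    by rewrite HF.2 h2.2 lerD2r semiconj_ub.
  move=> x n; apply/eqP; rewrite eq_le le_n /=.
  by have := le_n (x + n%:~R) (- n); rewrite rmorphN /= addrK; lra.
- exact: extension_central.
- exact: extension_lift1.
- exact: extension_lift2.
have le_e e x : semiconj (lift1 e x) <= lift2 e (semiconj x).
  have [[_ _ HF' _ _] [_ _ _ _ d2]] := extensionP e.
  apply: semiconj_le => k; rewrite -[X in X <= _]d2 (HomeoZ_le HF').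
  exact: semiconj_ub (k * e)%g.
move=> e x; apply/eqP; rewrite eq_le le_e /=.
have [[_ _ HF' _ _] [_ c1 _ _ d2]] := extensionP e.
have := le_e e^-1%g (lift1 e x).
have -> : lift1 e^-1%g (lift1 e x) = x := c1 x.
by rewrite -(HomeoZ_le HF') [X in _ <= X]d2.
Qed.

End Matching.

(** * Ping-pong partitions *)

Lemma virtually_free_infinite (G : groupType) :
  virtually_free G -> infinite_set [set: G].
Proof.
move=> [_ _ nvc] finG; apply: nvc; exists 1%g, setT => // g.
exists g, 1%g; split=> //; last by rewrite mulg1.
by move=> H [[H1 _ _] _].
Qed.

Lemma component_sub (T : topologicalType) (O I : set T) :
  components O I -> I `<=` O.
Proof. by move=> [x _ <-]; exact: connected_component_sub. Qed.

Lemma component_meet (T : topologicalType) (O I J : set T) :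
  components O I -> components O J -> I `&` J !=set0 -> I = J.
Proof.
move=> [x _ <-] [y _ <-] [z [xz yz]].
by rewrite (same_connected_component xz) (same_connected_component yz).
Qed.

Lemma component_exists (T : topologicalType) (O : set T) x : O x ->
  exists2 I, components O I & I x.
Proof.
move=> Ox; exists (connected_component O x); first by exists x.
exact: connected_component_refl.
Qed.

Section Generators.
Variables (G : groupType) (M : marking G) (D : marking_data M).

Lemma vgroup_preferred (v : vert (quo D)) : vgroup v `<=` preferred_generators D.
Proof. by move=> g vg; left; exists v. Qed.

Lemma egroup_preferred (e : edge (quo D)) : egroup e `<=` preferred_generators D.
Proof. by move=> g /egroup_sub; exact: vgroup_preferred. Qed.

Lemma selt_preferred (s : edge (quo D)) : stable_edge s ->
  preferred_generators D (selt s).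
Proof.
move=> ss; right; exists s, 1%g; rewrite mul1g; split=> //.
exact: actE1.
Qed.

(** A smaller generating set, which is visibly made of preferred generators whose
    inverses are preferred generators as well. *)
Definition basic_generators : set G :=
  [set g | (exists v : vert (quo D), vgroup v g) \/
           exists2 s : edge (quo D), stable_edge s & g = selt s].

Lemma basic_preferred g : basic_generators g ->
  preferred_generators D g /\ preferred_generators D g^-1%g.
Proof.
move=> [[v vg]|[s ss ->]].
  split; apply: (vgroup_preferred (v := v)) => //.
  by move: vg; rewrite /vgroup /= => /(congr1 (actV g^-1%g)); rewrite actVK.
split; first exact: selt_preferred.
have [_ _ _ <- _] := stable_edgeP ss.
by apply: selt_preferred; exact: stable_edge_rev.
Qed.

Lemma basic_generate (H : set G) : H 1%g ->
  (forall g h, H g -> H h -> H (g * h)%g) -> basic_generators `<=` H ->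
  forall g, H g.
Proof.
move=> H1 HM Hb; apply: generation => //.
  by move=> v g vg; apply: Hb; left; exists v.
by move=> s ss; apply: Hb; right; exists s.
Qed.

End Generators.

Section Partition.
Variables (R : realType) (G : groupType) (M : marking G) (D : marking_data M).
Variables (rho : G -> circle R -> circle R) (Th : atom_family D R).
Hypothesis infG : infinite_set [set: G].
Hypothesis HTh : ping_pong_partition rho Th.

Let IF := PPP1_family HTh.

Lemma atoms_meet_eq O1 O2 : atoms Th O1 -> atoms Th O2 ->
  O1 `&` O2 !=set0 -> O1 = O2.
Proof.
have UV e s x : stable_edge s -> atomU Th e x -> ~ atomV Th s x.
  move=> ss Ux Vx; have := IF1_XZ IF (org e) ss; apply/eqP/set0P.
  by exists x; split=> //; exists e.
move=> [[e1 ->]|[s1 ss1 ->]] [[e2 ->]|[s2 ss2 ->]] [x [x1 x2]].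
- have o12 : org e1 = org e2.
    by apply: (IF1_X IF) => //; exists x; split; [exists e1|exists e2].
  suff -> : e1 = e2 by [].
  by apply: (PPP1_disjoint HTh (v := org e2)) => //; exists x.
- by have := UV _ _ _ ss2 x1.
- by have := UV _ _ _ ss1 x2.
- suff -> : s1 = s2 by [].
  by apply: (IF1_Z IF) => //; exists x.
Qed.

(** Two disjoint atoms are non-empty: those of a stable edge and of its reverse,
    or those of two edges of the spanning tree that face each other. *)
Lemma atom_neq_setT O : atoms Th O -> O <> setT.
Proof.
move=> aO OT.
have two O1 O2 : atoms Th O1 -> atoms Th O2 -> O1 !=set0 -> O2 !=set0 ->
    O1 `&` O2 !=set0.
  move=> a1 a2 [x1 O1x] [x2 O2x].
  have -> : O1 = O by apply: atoms_meet_eq => //; exists x1; rewrite OT.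
  have -> : O2 = O by apply: atoms_meet_eq => //; exists x2; rewrite OT.
  by exists x1; rewrite OT.
have [[s ss]|nst] := pselect (exists s : edge (quo D), stable_edge s).
  have ss' := stable_edge_rev ss.
  have := two (atomV Th s) (atomV Th (rev s)).
  case; [by right; exists s|by right; exists (rev s)|exact: (IF1_Z0 IF)|exact: (IF1_Z0 IF)|].
  move=> x xs; have := IF1_Z IF ss ss' (ex_intro _ x xs) => srev.
  by have := rev_neq s; rewrite -srev eqxx.
have {}nst s : ~ @stable_edge _ _ D s by move=> ss; apply: nst; exists s.
have te e : @tree_edge _ _ D e by apply: contrapT => /nst.
have [e1 [e2 [p [s1 s2 [z w] r lp]]]] := facing_specified infG nst.
have := two (atomU Th e1) (atomU Th e2).
case; [by left; exists e1|by left; exists e2|exact: (IF5 IF s1).1|exact: (IF5 IF s2).1|].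
move=> x [x1 x2].
have o12 : org e1 = org e2.
  by apply: (IF1_X IF) => //; exists x; split; [exists e1|exists e2].
have : e1 :: p = [::]; last by [].
apply: (@closed_tree_walk _ _ _ (org e1)) => //.
have zE : z = org e1.
  rewrite o12 -tgt_rev -lp; case/lastP: (p) w => [|q f] /=; first by move=> /eqP.
  by move=> /walk_rcons[_ <-]; rewrite last_rcons.
by rewrite -{2}zE /= eqxx.
Qed.

Lemma atom_components_arcs : disjoint_arcs_family (atom_components Th).
Proof.
split=> [I [A aA cI]|I J [A1 a1 c1] [A2 a2 c2] IJ].
  have [a [b [ab ba ->]]] :=
    component_arc (PPP_open HTh aA) (atom_neq_setT aA) cI.
  by exists b, a.
suff A12 : A1 = A2 by rewrite A12 in c1; exact: component_meet c1 c2 IJ.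
apply: atoms_meet_eq => //; have [x [Ix Jx]] := IJ.
by exists x; split; [exact: component_sub c1 _ Ix|exact: component_sub c2 _ Jx].
Qed.

(** If g maps I into K and its inverse maps K into an interval, then the latter
    meets I, so that it is I and g maps I onto K. *)
Lemma generator_not_contracting g : circle_representation rho ->
  preferred_generators D g -> preferred_generators D g^-1%g ->
  (exists I, atom_components Th I) ->
  let full k := exists2 I, atom_components Th I &
     atom_components Th (rho k @` I) \/ markovian (atom_components Th) (rho k @` I) in
  full g \/ full g^-1%g.
Proof.
move=> [[rho1 rhoM] Hplus] pg pgV [I iI] full.
have sub k J : atom_components Th J -> (exists2 O, atoms Th O & rho k @` J `<=` O) ->
    exists2 K, atom_components Th K & rho k @` J `<=` K.
  move=> [A1 a1 [x A1x JE]] [A aA kJ]; exists (connected_component A (rho k x)).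
    exists A => //; exists (rho k x) => //; apply: kJ; exists x => //.
    by rewrite -JE; exact: connected_component_refl.
  apply: connected_component_max => //.
    by exists x => //; rewrite -JE; exact: connected_component_refl.
  rewrite -JE; apply: connected_continuous_connected.
    exact: component_connected.
  by apply: continuous_subspaceT; exact: (Hplus k).1.1.
have [/(sub _ _ iI)[K iK gIK]|mk] := PPP3 HTh pg iI; last by left; exists I; auto.
have [/(sub _ _ iK)[L iL gKL]|mk] := PPP3 HTh pgV iK; last by right; exists K; auto.
left; exists I => //; left.
have IL : I `<=` L.
  move=> x Ix; apply: gKL; exists (rho g x); last by rewrite -rhoM mulVg rho1.
  by apply: gIK; exists x.
have [z Iz] := right_end_nonempty (projT2 (cid (atom_components_arcs.1 _ iI))).
have LE : I = L.
  by apply: atom_components_arcs.2 => //; exists z; split=> //; exact: IL.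
suff -> : rho g @` I = K by [].
apply/seteqP; split=> // y Ky; exists (rho g^-1%g y).
  by rewrite LE; apply: gKL; exists y.
by rewrite -rhoM mulgV rho1.
Qed.

End Partition.

Section Equivalence.
Variables (R : realType) (G : groupType) (M : marking G) (D : marking_data M).
Variables (rho rho' : G -> circle R -> circle R) (Th Th' : atom_family D R).
Variable theta : set (circle R) -> set (circle R).
Hypothesis infG : infinite_set [set: G].
Hypotheses (Hrho : circle_representation rho) (Hrho' : circle_representation rho').
Hypotheses (HTh : ping_pong_partition rho Th) (HTh' : ping_pong_partition rho' Th').
Hypothesis Htheta : ping_pong_equivalence rho rho' Th Th' theta.

Let IF := PPP1_family HTh.
Let II := atom_components Th.
Let II' := atom_components Th'.
Let HII : disjoint_arcs_family II := atom_components_arcs infG HTh.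
Let HII' : disjoint_arcs_family II' := atom_components_arcs infG HTh'.

(** The trace of the atom O on the pairs of corresponding points. *)
Definition joint (O : set (circle R)) : set (circle R * circle R) :=
  [set p | exists I, [/\ components O I, I p.1 & theta I p.2]].

Definition joint_act g (p : circle R * circle R) := (rho g p.1, rho' g p.2).

Lemma joint_actP : is_action joint_act.
Proof.
split=> [[x y]|g h [x y]]; rewrite /joint_act /=.
  by rewrite Hrho.1.1 Hrho'.1.1.
by rewrite Hrho.1.2 Hrho'.1.2.
Qed.

Lemma joint_sub O p : joint O p -> O p.1.
Proof. by move=> [I [cI Ip _]]; exact: component_sub cI _ Ip. Qed.

Lemma joint_nonempty O : atoms Th O -> O !=set0 -> joint O !=set0.
Proof.
move=> aO [x Ox]; have [I cI Ix] := component_exists Ox.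
have iI : II I by exists O.
have [b rb] := HII'.1 _ (theta_in (PPE1_bij Htheta) iI).
by have [y Iy] := right_end_nonempty rb; exists (x, y), I.
Qed.

Lemma joint_image g O1 O2 p : preferred_generators D g ->
  atoms Th O1 -> atoms Th O2 -> rho g @` O1 `<=` O2 ->
  joint O1 p -> joint O2 (joint_act g p).
Proof.
move=> pg a1 a2 gO [I [cI Ip Ip']].
have gI : rho g @` I `<=` O2.
  move=> _ [y Iy <-]; apply: gO; exists y => //.
  exact: component_sub cI _ Iy.
have gp : (rho g @` I) (rho g p.1) by exists p.1.
pose K := connected_component O2 (rho g p.1).
have cK : components O2 K by exists (rho g p.1) => //; exact: gI.
have gIK : rho g @` I `<=` K.
  apply: connected_component_max => //.
  apply: connected_continuous_connected.
    by have [x _ <-] := cI; exact: component_connected.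
  by apply: continuous_subspaceT; exact: (Hrho.2 g).1.1.
exists K; split=> //; first exact: gIK.
apply: (PPE2_sub Htheta pg _ _ gIK); [by exists O1|by exists O2|].
by exists p.2.
Qed.

Definition joint_X (v : vert (quo D)) : set (circle R * circle R) :=
  [set p | exists2 e, org e = v & joint (atomU Th e) p].
Definition joint_Z (s : edge (quo D)) := joint (atomV Th s).
Definition joint_Xe (e : edge (quo D)) := joint (atomU Th e).

Lemma atomU_atom (e : edge (quo D)) : atoms Th (atomU Th e).
Proof. by left; exists e. Qed.

Lemma atomV_atom (s : edge (quo D)) : stable_edge s -> atoms Th (atomV Th s).
Proof. by right; exists s. Qed.

(** The inclusions between atoms required of an interactive family hold component
    by component, and the equivalence preserves them. Disjointness is inherited
    from the first factor. *)
Lemma joint_interactive : interactive_family joint_act joint_X joint_Z joint_Xe.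
Proof.
have XU v p : joint_X v p -> unionU Th v p.1.
  by move=> [e ev /joint_sub Up]; exists e.
have U := atomU_atom; have V := atomV_atom.
split.
- move=> v w _ _ [p [pv pw]]; apply: (IF1_X IF) => //.
  by exists p.1; split; exact: XU.
- move=> s t ss st [p [ps pt]]; apply: (IF1_Z IF) => //.
  by exists p.1; split; exact: joint_sub.
- move=> v s ss; apply/seteqP; split=> // p [/XU pX /joint_sub pZ].
  have : (unionU Th v `&` atomV Th s) p.1 by split.
  by rewrite (IF1_XZ IF v ss).
- by move=> s ss; apply: joint_nonempty (V _ ss) (IF1_Z0 IF ss).
- move=> e /(IF1_X0 IF)[x [f fe fx]].
  have [p pU] := joint_nonempty (U f) (ex_intro _ x fx).
  by exists p, f.
- move=> s v ss _ [p [e ev pU] <-].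
  apply: joint_image (selt_preferred ss) (U e) (V _ ss) _ pU => _ [y Uy <-].
  by apply: (IF2_X IF ss (v := v)); exists y => //; exists e.
- move=> s s' ss ss' ne _ [p pZ <-].
  apply: joint_image (selt_preferred ss) (V _ ss') (V _ ss) _ pZ.
  exact: (IF2_Z IF).
- move=> s ss _ [a as_ [p pZ <-]].
  apply: joint_image (egroup_preferred as_) (V _ ss) (V _ ss) _ pZ => _ [y Vy <-].
  by apply: (IF3 IF ss); exists a => //; exists y.
- move=> s ss _ [a [va na] [p pZ <-]]; exists s => //.
  apply: joint_image (vgroup_preferred va) (V _ ss) (U s) _ pZ => _ [y Vy <-].
  by apply: (PPP1_outer HTh ss); exists a => //; exists y.
- move=> e /[dup] [[te ve]] /(IF5 IF)[U0 _]; split; first exact: joint_nonempty.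
  by move=> p pU; exists e.
- move=> e sp _ [a ea [p pU <-]].
  apply: joint_image (egroup_preferred ea) (U e) (U e) _ pU => _ [y Uy <-].
  by apply: (IF6 IF sp); exists a => //; exists y.
- move=> e v sp ev _ [a [va na] [p [f fv pU] <-]].
  apply: joint_image (vgroup_preferred va) (U f) (U e) _ pU => _ [y Uy <-].
  by apply: (IF7 IF sp ev); exists a => //; exists y => //; exists f.
- move=> e s sp ss es _ [a [va na] [p pZ <-]].
  apply: joint_image (vgroup_preferred va) (V _ ss) (U e) _ pZ => _ [y Vy <-].
  by apply: (IF8 IF sp ss es); exists a => //; exists y.
Qed.

Lemma corresponding_orbit (K : seq G) : exists x x', forall k, k \in K ->
  corresponding II theta (rho k x) (rho' k x').
Proof.
have [[x x'] xP] := covered_orbit infG joint_actP joint_interactive K.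
exists x, x' => k kK; have := xP k kK.
case=> [[v [e ev [I [cI Ix Ix']]]]|[s ss [I [cI Ix Ix']]]]; exists I; split=> //.
  by exists (atomU Th e) => //; exact: atomU_atom.
by exists (atomV Th s) => //; exact: atomV_atom.
Qed.

(** A generator carries the right end of an interval to the right end of its image,
    or to that of the last interval of its Markovian image. *)
Lemma full_cuts g F F' : preferred_generators D g ->
  HomeoZ F -> lifts F (rho g) -> HomeoZ F' -> lifts F' (rho' g) ->
  (exists2 I, II I & II (rho g @` I) \/ markovian II (rho g @` I)) ->
  exists b b', corresponding_cuts II theta b b' /\
    corresponding_cuts II theta (F b) (F' b').
Proof.
move=> pg HF lF HF' lF' [I iI full].
have iI' := theta_in (PPE1_bij Htheta) iI.
have [b rb] := HII.1 _ iI; have [b' rb'] := HII'.1 _ iI'.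
exists b, b'; split; first by exists I.
case: full => [iK|[m [Is [Js dec]]]].
  exists (rho g @` I); split=> //; first exact: right_end_image rb.
  rewrite -(PPE2_eq Htheta pg iI iK erefl); exact: right_end_image rb'.
have [Js' [gc dec']] := PPE2_markovian Htheta pg iI dec.
exact: (markovian_cuts HII HII' (PPE1_bij Htheta) HF lF HF' lF' rb rb' dec gc dec').
Qed.

Lemma basic_cuts g F F' : basic_generators D g ->
  HomeoZ F -> lifts F (rho g) -> HomeoZ F' -> lifts F' (rho' g) ->
  exists b b', corresponding_cuts II theta b b' /\
    corresponding_cuts II theta (F b) (F' b').
Proof.
move=> /basic_preferred[pg pgV] HF lF HF' lF'.
have [x [x' /(_ 1%g (mem_head _ _))[I0 [iI0 _ _]]]] := corresponding_orbit [:: 1%g].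
have [full|full] := generator_not_contracting infG HTh Hrho pg pgV (ex_intro _ _ iI0).
  exact: full_cuts full.
have [Fi [HFi FK FiK]] := HomeoZ_inv HF.
have [Fi' [HFi' FK' FiK']] := HomeoZ_inv HF'.
have lFi : lifts Fi (rho g^-1%g) := lifts_inv lF FiK (representationK g Hrho).
have lFi' : lifts Fi' (rho' g^-1%g) := lifts_inv lF' FiK' (representationK g Hrho').
have [b [b' [cb cFb]]] := full_cuts pgV HFi lFi HFi' lFi' full.
by exists (Fi b), (Fi' b'); rewrite FiK FiK'.
Qed.

Lemma equivalence_semi_conjugate : semi_conjugate rho rho'.
Proof.
have [x0 [x0' /(_ 1%g (mem_head _ _))[I0 [iI0 _ _]]]] := corresponding_orbit [:: 1%g].
have [beta rbeta] := HII.1 _ iI0.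
have [beta' rbeta'] := HII'.1 _ (theta_in (PPE1_bij Htheta) iI0).
have cbeta : corresponding_cuts II theta beta beta' by exists I0.
apply: (@matching_semi_conjugate R G rho rho' Hrho Hrho' (corresponding II theta)
  (matched II theta beta beta') (1 + `|beta - beta'|) _ _ _ corresponding_orbit
  (@basic_generators G M D)).
- move=> t t' tt'; exists (Num.floor (t - beta) - Num.floor (t' - beta')).
  split; first by rewrite circle_pi_shift.
  set n : int := _ - _; have -> : t' + n%:~R - beta' = t' - (beta' + (- n)%:~R).
    by rewrite rmorphN /=; lra.
  by rewrite floor_shift /n; lia.
- move=> t t' n m [tt' fl]; rewrite /matched !circle_pi_shift.
  have sh (u b : R) (k : int) : Num.floor (u + k%:~R - b) = Num.floor (u - b) + k.
    have -> : u + k%:~R - b = u - (b + (- k)%:~R) by rewrite rmorphN /=; lra.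
    by rewrite floor_shift; lia.
  by rewrite !sh fl; split=> [[_ /addrI]|->].
(* Two numbers with the same integral part are at distance less than 1. *)
- move=> t t' [_ fl]; have := floor_itv (t - beta).
  have := floor_itv (t' - beta').
  rewrite fl rmorphD /= => h1 h2; have := ler_norm (beta - beta').
  by have := ler_norm (beta' - beta); rewrite distrC ler_norml; lra.
- exact: basic_generate.
move=> g bg; have [_ [F HF lF]] := Hrho.2 g; have [_ [F' HF' lF']] := Hrho'.2 g.
have [b [b' [cb cFb]]] := basic_cuts bg HF lF HF' lF'.
have [q qP] := cuts_matched HII HII' (PPE1_bij Htheta) (PPE1_cyclic Htheta)
  HF lF HF' lF' cbeta cb cFb.
exists F, (fun x => F' x + q%:~R); split=> //.
  exact: HomeoZ_shift.
exact: lifts_shift.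
Qed.

End Equivalence.

Theorem theorem2 (R : realType) (G : groupType) (M : marking G)
    (D : marking_data M)
    (rho rho' : G -> circle R -> circle R)
    (Th Th' : atom_family D R)
    (HG : virtually_free G)
    (Hrho : circle_representation rho)
    (Hrho' : circle_representation rho')
    (HTh : proper_ping_pong_partition rho Th)
    (HTh' : proper_ping_pong_partition rho' Th')
    (Heq : equivalent_partitions rho rho' Th Th') :
  semi_conjugate rho rho'.
Proof.
have [theta Htheta] := Heq.
exact: (equivalence_semi_conjugate (virtually_free_infinite HG) Hrho Hrho'
  HTh.1 HTh'.1 Htheta).
Qed.
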